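(* Suppose $-1<\beta<1$. Then, for all $x\geq 0$, $$\left|\frac{e^{-\beta x}I_{\nu}(x)}{x^{\nu}}\int_x^{\infty}e^{\beta t}t^{\nu}K_{\nu}(t)\,dt\right|<\frac{\sqrt{\pi}\,\Gamma(\nu+\frac{1}{2})}{(1-\beta^2)^{\nu+\frac{1}{2}}\,\Gamma(\nu+1)}\quad\text{for every real }\nu\geq\tfrac{1}{2},$$ and $$\left|\frac{e^{-\beta x}I_{\nu}(x)}{x^{\nu}}\int_x^{\infty}e^{\beta t}t^{\nu}K_{\nu}(t)\,dt\right|<\frac{(e+1)\,2^{\nu}\,\Gamma(\nu+\frac{1}{2})}{1-|\beta|}\quad\text{for every real }\nu\text{ with }|\nu|<\tfrac{1}{2}.$$
   Context: Here $\nu$ and $\beta$ are real, $I_\nu$ and $K_\nu$ denote the modified Bessel functions of the first and second kind, respectively, of order $\nu$, and $\Gamma$ is the gamma function. At $x=0$ the expressions are understood as their limits as $x\downarrow 0$. *)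

(* Defs.v *)
From mathcomp Require Import all_boot all_order all_algebra.
From mathcomp Require Import all_classical all_reals all_analysis.
Set Implicit Arguments.
Unset Strict Implicit.
Unset Printing Implicit Defensive.
Import Order.TTheory GRing.Theory Num.Theory.
Import numFieldNormedType.Exports.
Local Open Scope classical_set_scope.
Local Open Scope ring_scope.

(* Euler's integral; it is the gamma function only for 0 < a. *)
Definition Gamma (R : realType) (a : R) : R :=
  \int[@lebesgue_measure R]_(t in `]0, +oo[) (t `^ (a - 1) * expR (- t)).

(* I_nu(x) for 0 < x and -1 < nu, so that Gamma has positive arguments only:
   sum over k of (x/2)^(nu + 2k) / (k! Gamma(nu + k + 1)). *)
Definition besselI (R : realType) (nu x : R) : R :=
  limn (series (fun k : nat =>
    (x / 2) `^ (nu + (2 * k)%:R) / (k`!%:R * Gamma (nu + k%:R + 1)))).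

Definition cosh (R : realType) (t : R) : R := (expR t + expR (- t)) / 2.

(* K_nu(x) for 0 < x and every real nu. *)
Definition besselK (R : realType) (nu x : R) : R :=
  \int[@lebesgue_measure R]_(t in `[0, +oo[)
    (expR (- (x * cosh t)) * cosh (nu * t)).

Definition bessel_integrand (R : realType) (beta nu t : R) : R :=
  expR (beta * t) * t `^ nu * besselK nu t.

Definition bessel_expr (R : realType) (beta nu x : R) : R :=
  expR (- (beta * x)) * besselI nu x / x `^ nu *
  \int[@lebesgue_measure R]_(t in `[x, +oo[) bessel_integrand beta nu t.

Definition extend0 (R : realType) (f : R -> R) (x : R) : R :=
  if x == 0 then lim (f y @[y --> 0^'+]) else f x.

(* [Rintegral] and [lim] are total operators with a default value; this says
   that every integral, and the limit at 0, in the expression truly exist. *)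
Definition bessel_expr_defined (R : realType) (beta nu : R) : Prop :=
  (forall x : R, 0 < x ->
    (@lebesgue_measure R).-integrable `[x, +oo[
      (EFin \o bessel_integrand beta nu)) /\
  cvg (bessel_expr beta nu y @[y --> 0^'+]).

(* Main.v *)
Require Import Defs.
From mathcomp Require Import all_boot all_order all_algebra.
From mathcomp Require Import all_classical all_reals all_analysis.
From mathcomp Require Import measurable_realfun ring lra.
Import Order.TTheory GRing.Theory Num.Theory.
Import numFieldNormedType.Exports.
Local Open Scope classical_set_scope.
Local Open Scope ring_scope.

(** After the substitution u = e^v, Euler's integral and the modified Bessel
function of the second kind are instances of one integral,
[gig a p y = \int_0^oo u^(a-1) e^(-pu-y/u) du]: Gamma(a) = gig a 1 0 and
t^nu K_nu(t) = 2^(nu-1) gig nu 1 (t^2/4).  Put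
G(x) = (x/2)^(-nu) I_nu(x) and H(t) = gig nu 1 (t^2/4).  Shifting the variable,
the expression to bound is 1/2 \int_0^oo e^(beta s) G(x) H(x+s) ds.

For each s > 0 the product G(x) H(x+s) is nonincreasing in x.  Indeed, let
r = G'/G at x and q = -H'/H at y >= x.  The ODE of I_nu gives
r^2 + (2nu+1) r/x <= 1.  If nu >= 1/2, the Turan inequality
K_nu^2 <= K_(nu-1) K_(nu+1) reads q^2 + 2nu q/y >= 1, which forces r <= q;
if |nu| < 1/2, then r <= 1 <= q because K_(nu-1) >= K_nu pointwise.

So the expression is nonincreasing in x, hence it has a limit at 0 and is
bounded by 1/(2 Gamma(nu+1)) \int_0^oo e^(beta s) H(s) ds.  Adding the same
quantity for -beta gives an integral over the whole line, which Tonelli and the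
Gaussian integral evaluate to exactly the right-hand side of the first bound.
The second bound follows from 2 <= (e+1) 2^nu Gamma(nu+1). *)

(** * Changes of variable and strict positivity for Lebesgue integrals *)

Lemma lebesgue_measure_translation (R : realType) (c : R) (A : set R) :
  measurable A ->
  pushforward lebesgue_measure ((fun x => x + c) : _ -> measurableTypeR R) A =
  lebesgue_measure A.
Proof.
move=> mA; apply/esym.
have mc : measurable_fun [set: measurableTypeR R]
    ((fun x => x + c) : _ -> measurableTypeR R).
  by apply: measurable_funD => //; exact: measurable_cst.
(* A measure that agrees with Lebesgue measure on half-open intervals equals it, and translation
   keeps the length of an interval. *)
apply: (@lebesgue_measure_unique R (pushforward lebesgue_measure
  ((fun x => x + c) : _ -> measurableTypeR R))) => //= _ [[a b]] _ <-.
rewrite /pushforward (_ : _ @^-1` _ = `]a - c, b - c]%classic); last first.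
  by apply/seteqP; split => x /=; rewrite !in_itv/= ltrBlDr lerBrDr.
rewrite !lebesgue_measure_itv/= !lte_fin ltrD2r; case: ifP => // _.
by rewrite -!EFinB; congr EFin; ring.
Qed.

Lemma ge0_integral_translation (R : realType) (c : R) (A : set R)
    (f : R -> \bar R) :
  measurable A -> measurable_fun A f -> (forall x, A x -> (0 <= f x)%E) ->
  (\int[lebesgue_measure]_(x in A) f x =
   \int[lebesgue_measure]_(x in [set x | A (x + c)%R]) f (x + c)%R)%E.
Proof.
move=> mA mf f0.
have mc : measurable_fun [set: measurableTypeR R]
    ((fun x => x + c) : _ -> measurableTypeR R).
  by apply: measurable_funD => //; exact: measurable_cst.
transitivity (\int[pushforward lebesgue_measure
  ((fun x => x + c)%R : _ -> measurableTypeR R)]_(x in A) f x)%E.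
  apply: eq_measure_integral => //= B mB BA.
  exact/esym/lebesgue_measure_translation.
by rewrite ge0_integral_pushforward// => x /set_mem; exact: f0.
Qed.

Lemma ge0_integral_reflection (R : realType) (A : set R) (f : R -> \bar R) :
  measurable A -> measurable_fun A f -> (forall x, A x -> (0 <= f x)%E) ->
  (\int[lebesgue_measure]_(x in A) f x =
   \int[lebesgue_measure]_(x in [set x | A (- x)%R]) f (- x)%R)%E.
Proof.
move=> mA mf f0.
have mN : measurable_fun [set: measurableTypeR R]
    (-%R : _ -> measurableTypeR R).
  exact: measurable_funN.
transitivity (\int[pushforward lebesgue_measure
  (-%R : _ -> measurableTypeR R)]_(x in A) f x)%E.
  apply: eq_measure_integral => //= B mB BA.
  exact/esym/lebesgue_measureN.
by rewrite ge0_integral_pushforward// => x /set_mem; exact: f0.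
Qed.

Lemma ge0_integral_split0 (R : realType) (f : R -> \bar R) :
  measurable_fun setT f -> (forall x, (0 <= f x)%E) ->
  (\int[lebesgue_measure]_x f x =
   \int[lebesgue_measure]_(x in `]0%R, +oo[) f x +
   \int[lebesgue_measure]_(x in `]0%R, +oo[) f (- x)%R)%E.
Proof.
move=> mf f0.
rewrite (_ : setT = `]-oo, 0%R] `|` `]0%R, +oo[); last first.
  by rewrite -itv_bndbnd_setU// set_itvNyy.
rewrite ge0_integral_setU//=; last 2 first.
- by apply: measurable_funTS.
- apply/disj_setPS => x [] /=; rewrite !in_itv/= andbT => x0.
  by rewrite ltNge x0.
rewrite addeC; congr (_ + _)%E.
rewrite ge0_integral_reflection//=; last exact: measurable_funTS.
rewrite (_ : [set x | _] = `[0, +oo[%classic); last first.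
  by apply/seteqP; split => x /=; rewrite !in_itv/= ?andbT oppr_le0.
rewrite integral_itv_obnd_cbnd//.
apply: measurable_funTS.
by apply: measurableT_comp => //; exact: measurable_funN.
Qed.

(** Substitution on the compact intervals [e^(-n), e^n] and [-n, n], followed by monotone
    convergence along both increasing unions. *)
Lemma ge0_integral_expR_subst (R : realType) (f : R -> R) :
  {in `]0, +oo[, continuous f} -> (forall x, 0 < x -> 0 <= f x) ->
  (\int[lebesgue_measure]_(x in `]0%R, +oo[) (f x)%:E =
   \int[lebesgue_measure]_x (f (expR x) * expR x)%:E)%E.
Proof.
move=> cf f0.
have cfe : continuous (fun x : R => f (expR x) * expR x).
  move=> x; apply: cvgM; last exact: continuous_expR.
  apply: continuous_comp; first exact: continuous_expR.
  by apply: cf; rewrite in_itv/= expR_gt0.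
pose A (n : nat) : set R := `[expR (- n%:R), expR n%:R]%classic.
pose B (n : nat) : set R := `[- n%:R, n%:R]%classic.
have bnd (y : R) : exists n : nat, - n%:R <= y <= n%:R.
  exists (Num.trunc `|y|).+1; rewrite -ler_norml ltW//; exact: truncnS_gt.
have ndA : nondecreasing_seq A.
  move=> m n mn; rewrite subsetEset /A => x; rewrite /= !in_itv/= => /andP[a b].
  rewrite (le_trans _ a)/= ?(le_trans b)// ler_expR ?lerN2 ler_nat//.
have ndB : nondecreasing_seq B.
  move=> m n mn; rewrite subsetEset /B => x; rewrite /= !in_itv/= => /andP[a b].
  by rewrite (le_trans _ a)/= ?(le_trans b)// ?lerN2 ler_nat.
have UA : \bigcup_n A n = `]0, +oo[%classic.
  apply/seteqP; split => x.
    move=> [n _]; rewrite /A /= !in_itv/= andbT => /andP[a _].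
    by rewrite (lt_le_trans _ a)// expR_gt0.
  rewrite /= in_itv/= andbT => x0; have [n /andP[a b]] := bnd (ln x).
  exists n => //; rewrite /A /= in_itv/= -[x]lnK ?posrE//.
  by rewrite !ler_expR a.
have UB : \bigcup_n B n = setT.
  apply/seteqP; split => x // _; have [n ab] := bnd x.
  by exists n => //; rewrite /B /= in_itv.
have dE : derive1 (@expR R) = expR.
  by apply/funext => z; rewrite derive1E derive_val.
have mA n : measurable (A n) by exact: measurable_itv.
have mB n : measurable (B n) by exact: measurable_itv.
have AB n : (\int[lebesgue_measure]_(x in A n) (f x)%:E =
    \int[lebesgue_measure]_(x in B n) (f (expR x) * expR x)%:E)%E.
  rewrite /A /B (@integration_by_substitution_increasing R expR f
    (- n%:R) n%:R).
  - by apply: eq_integral => x _; rewrite !fctE dE.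
  - by rewrite (@le_trans _ _ 0)// oppr_le0.
  - by move=> x y _ _; rewrite ltr_expR.
  - by move=> x _; rewrite dE; exact: continuous_expR.
  - rewrite dE; apply/cvg_ex; exists (expR (- n%:R)).
    exact/cvg_at_right_filter/continuous_expR.
  - rewrite dE; apply/cvg_ex; exists (expR n%:R).
    exact/cvg_at_left_filter/continuous_expR.
  - split.
    + by move=> x _; exact: derivable_expR.
    + exact/cvg_at_right_filter/continuous_expR.
    + exact/cvg_at_left_filter/continuous_expR.
  - apply: continuous_in_subspaceT => x; rewrite inE/= in_itv/= => /andP[a _].
    by apply: cf; rewrite in_itv/= andbT (lt_le_trans _ a)// expR_gt0.
have mfA : measurable_fun (\bigcup_n A n) (fun x => (f x)%:E).
  rewrite UA; apply/measurable_EFinP; apply: open_continuous_measurable_fun =>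
    //.
  by move=> x; rewrite inE/=; exact: cf.
have mfB : measurable_fun setT (fun x => (f (expR x) * expR x)%:E).
  by apply/measurable_EFinP; exact: continuous_measurable_fun.
have limA : (\int[lebesgue_measure]_(x in A n) (f x)%:E @[n --> \oo] -->
    \int[lebesgue_measure]_(x in \bigcup_n A n) (f x)%:E)%E.
  apply: ge0_nondecreasing_set_cvg_integral => //.
    by move=> n; apply: measurable_funS mfA; [rewrite UA|exact: bigcup_sup].
  move=> n x; rewrite /A /= in_itv/= => /andP[a _].
  by rewrite lee_fin f0// (lt_le_trans _ a)// expR_gt0.
have limB : (\int[lebesgue_measure]_(x in B n) (f (expR x) * expR x)%:E
    @[n --> \oo] -->
    \int[lebesgue_measure]_(x in \bigcup_n B n) (f (expR x) * expR x)%:E)%E.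
  apply: ge0_nondecreasing_set_cvg_integral => //.
    by move=> n; apply: measurable_funTS.
  by move=> n x _; rewrite lee_fin mulr_ge0 ?expR_ge0// f0// expR_gt0.
rewrite UA in limA; rewrite UB in limB.
rewrite (eq_cvg _ _ AB) in limA.
exact: cvg_unique limA limB.
Qed.

(** A zero integral would make f vanish almost everywhere on D, forcing D into a null set. *)
Lemma Rintegral_gt0 (R : realType) (D : set R) (f : R -> R) :
  measurable D -> (0 < lebesgue_measure D)%E ->
  lebesgue_measure.-integrable D (EFin \o f) ->
  (forall x, D x -> 0 < f x) -> 0 < \int[lebesgue_measure]_(x in D) f x.
Proof.
move=> mD D0 intf f0; rewrite lt_neqAle Rintegral_ge0 ?andbT; last first.
  by move=> x Dx; exact/ltW/f0.
apply/eqP => /esym I0.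
have If : (\int[lebesgue_measure]_(x in D) `|(f x)%:E| = 0)%E.
  rewrite (_ : (\int[_]_(_ in _) _)%E =
      (\int[lebesgue_measure]_(x in D) (f x)%:E)%E).
    rewrite -[LHS]fineK; last exact: integrable_fin_num.
    by congr EFin.
  by apply: eq_integral => x /set_mem Dx; rewrite /= gtr0_norm ?f0.
have [N [mN N0 sub]] : ae_eq lebesgue_measure D (EFin \o f) (cst 0%E).
  by apply/ae_eq_integral_abs => //; exact: measurable_int intf.
have : (lebesgue_measure D <= 0)%E; last by rewrite leNgt D0.
rewrite -N0; apply: le_measure; rewrite ?inE//.
move=> x Dx; apply: sub => /= /(_ Dx) [] fx0.
by have := f0 _ Dx; rewrite fx0 ltxx.
Qed.

Lemma integrable_expRN_norm (R : realType) (d : R) : 0 < d ->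
  lebesgue_measure.-integrable setT
    (EFin \o (fun v : R => expR (- (d * `|v|)))).
Proof.
move=> d0.
have ce : continuous (fun v : R => expR (- (d * `|v|))).
  move=> v; apply: continuous_comp; last exact: continuous_expR.
  by apply: cvgN; apply: cvgM; [exact: cvg_cst|exact: norm_continuous].
apply/integrableP; split.
  by apply/measurable_EFinP; exact: continuous_measurable_fun.
under eq_integral do rewrite /= ger0_norm ?expR_ge0//.
rewrite ge0_symfun_integralT//; last by move=> v /=; rewrite normrN.
rewrite (_ : [set x | _] = `[0, +oo[%classic); last first.
  by apply/seteqP; split => x /=; rewrite in_itv/= andbT.
rewrite (@ge0_continuous_FTC2y _ _ (fun v => - d^-1 * expR (- d * v)) 0 0).
- by rewrite -EFinB -EFinM ltry.
- by move=> v _; exact: expR_ge0.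
- exact: continuous_subspaceT.
- rewrite -[X in _ --> X](mulr0 (- d^-1)); apply: cvgM; first exact: cvg_cst.
  have -> : (fun v : R => expR (- d * v)) = (fun v => expR (- v)) \o
    (fun v => d * v).
    by apply/funext => v /=; rewrite mulNr.
  apply: cvg_comp (@cvgr_expR R).
  by apply: gt0_cvgMry => //; exact: cvg_id.
- by move=> v _; exact: ex_derive.
- apply: cvg_at_right_filter; apply: cvgM; first exact: cvg_cst.
  apply: continuous_comp; last exact: continuous_expR.
  by apply: cvgM; [exact: cvg_cst|exact: cvg_id].
- move=> v; rewrite in_itv/= andbT => v0; rewrite derive1E derive_val.
  by rewrite gtr0_norm// /GRing.scale/= (mulNr d v); field; rewrite gt_eqF.
Qed.

(** * The integral of u^(a-1) exp(-pu-y/u) in the variable u = e^v *)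

Section gig.
Variable R : realType.
Implicit Types a p y v c : R.

(** With u = e^v this is u^a e^(-pu-y/u), one factor u coming from du = u dv. On the whole line,
    scaling u becomes a translation of v, and inverting u a reflection. *)
Definition gig_kernel a p y v : R :=
  expR (a * v - p * expR v - y * expR (- v)).

Definition gig a p y : R := \int[lebesgue_measure]_v gig_kernel a p y v.

Lemma gig_kernel_gt0 a p y v : 0 < gig_kernel a p y v.
Proof. exact: expR_gt0. Qed.

Lemma continuous_gig_kernel a p y : continuous (gig_kernel a p y).
Proof.
move=> v; apply: continuous_comp; last exact: continuous_expR.
apply: cvgB; last first.
  apply: cvgM; first exact: cvg_cst.
  by apply: continuous_comp; [exact: opp_continuous|exact: continuous_expR].
apply: cvgB; apply: cvgM; [exact: cvg_cst|exact: cvg_id|exact: cvg_cst|].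
exact: continuous_expR.
Qed.

Lemma gig_kernelDl a p y v c :
  gig_kernel (a + c) p y v = expR (c * v) * gig_kernel a p y v.
Proof. by rewrite /gig_kernel -expRD; congr expR; ring. Qed.

(** The maximum is at e^v = c/p; the bound is e^w >= 1 + w at w = v - ln (c/p). *)
Lemma linear_subexp_bounded c p v : 0 < p -> 0 < c ->
  c * v - p * expR v <= c * (ln (c / p) - 1).
Proof.
move=> p0 c0.
have := expR_ge1Dx (v - ln (c / p)).
rewrite expRD expRN lnK ?posrE ?divr_gt0// => h.
have {}h := ler_wpM2l (ltW c0) h.
have e : c * (expR v * (c / p)^-1) = p * expR v.
  by rewrite invf_div mulrCA [c * _]mulrC divfK ?gt_eqF// mulrC.
by rewrite e in h; lra.
Qed.

(** Only growth of e^(cv) has to be controlled: by p e^v if c > 0, by y e^(-v) if c < 0. *)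
Lemma gig_kernel_bounded c p y : 0 < p -> 0 <= y -> (0 < y) || (0 <= c) ->
  exists M, forall v, gig_kernel c p y v <= M.
Proof.
move=> p0 y0 yc.
have pe v : 0 <= p * expR v by rewrite mulr_ge0 ?expR_ge0// ltW.
have ye v : 0 <= y * expR (- v) by rewrite mulr_ge0 ?expR_ge0.
have [c0|c0|c0] := ltgtP c 0.
- have {}y0 : 0 < y by case/orP: yc => //; rewrite leNgt c0.
  exists (expR (- c * (ln (- c / y) - 1))) => v; rewrite ler_expR.
  have := @linear_subexp_bounded (- c) y (- v) y0; rewrite oppr_gt0 => /(_ c0).
  by rewrite mulrNN; have := pe v; lra.
- exists (expR (c * (ln (c / p) - 1))) => v; rewrite ler_expR.
  by have := linear_subexp_bounded c p v p0 c0; have := ye v; lra.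
- exists 1 => v; rewrite /gig_kernel -[leRHS]expR0 ler_expR c0 mul0r.
  by have := ye v; have := pe v; lra.
Qed.

(* Domination by C e^(-d|v|): for y = 0 < a the choice d = a keeps
   e^((a - d) v - p e^v) bounded as v tends to -oo. *)
Lemma integrable_gig_kernel a p y : 0 < p -> 0 <= y -> (0 < y) || (0 < a) ->
  lebesgue_measure.-integrable setT (EFin \o gig_kernel a p y).
Proof.
move=> p0 y0 ya.
have [d d0 yd] : exists2 d, 0 < d & (0 < y) || (0 <= a - d).
  by case/orP: ya => h; [exists 1; rewrite ?h|exists a;
    rewrite ?subrr ?lexx ?orbT].
have [M1 M1P] : exists M, forall v, gig_kernel (a + d) p y v <= M.
  apply: gig_kernel_bounded => //; case/orP: yd => [->//|h].
  by apply/orP; right; lra.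
have [M2 M2P] := @gig_kernel_bounded (a - d) p y p0 y0 yd.
apply: (le_integrable measurableT _ _
  (integrableZl measurableT (M1 + M2) (integrable_expRN_norm R d d0))).
- apply/measurable_EFinP; apply: continuous_measurable_fun.
  exact: continuous_gig_kernel.
- move=> v _; rewrite -EFinM /= lee_fin ger0_norm ?expR_ge0//.
  rewrite (le_trans _ (ler_norm _))//.
  have k0 := gig_kernel_gt0 a p y v.
  rewrite expRN ler_pdivlMr ?expR_gt0//.
  (* The kernel times e^(d|v|) is at most its product with e^(dv) + e^(-dv), which is the sum of the
     kernels of orders a + d and a - d. *)
  apply: (le_trans _ (lerD (M1P v) (M2P v))).
  rewrite !gig_kernelDl mulrC -mulrDl ler_pM2r//.
  have [v0|v0] := leP 0 v.
    by rewrite ger0_norm// lerDl expR_ge0.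
  by rewrite ltr0_norm// mulrN mulNr lerDr expR_ge0.
Qed.

Lemma gig_gt0 a p y : 0 < p -> 0 <= y -> (0 < y) || (0 < a) -> 0 < gig a p y.
Proof.
move=> p0 y0 ya; apply: Rintegral_gt0 => //.
- by rewrite -set_itvNyy lebesgue_measure_itv/= ltry.
- exact: integrable_gig_kernel.
- by move=> v _; exact: gig_kernel_gt0.
Qed.

Lemma EFin_gig a p y : 0 < p -> 0 <= y -> (0 < y) || (0 < a) ->
  (gig a p y)%:E = (\int[lebesgue_measure]_v (gig_kernel a p y v)%:E)%E.
Proof.
move=> p0 y0 ya; rewrite /gig /Rintegral fineK//.
exact: integrable_fin_num (integrable_gig_kernel _ _ _ p0 y0 ya).
Qed.

End gig.

Arguments gig_kernel {R} a p y v.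
Arguments gig {R} a p y.


(** * Differentiation of Laplace-type integrals *)

Lemma derivable_continuous (R : realType) (f : R -> R) (x : R) :
  derivable f x 1 -> {for x, continuous f}.
Proof. by move=> df; apply: differentiable_continuous;
  apply/derivable1_diffP. Qed.

(** For infinite x both sides are 0, so scalars can be moved out of an integral before its
    finiteness is known. *)
Lemma fine_scale (R : realType) (r : R) (x : \bar R) : 0 < r ->
  fine (r%:E * x)%E = r * fine x.
Proof.
move=> r0; case: x => [x||] //=.
- by rewrite mulry gtr0_sg// mul1e /= mulr0.
- by rewrite mulrNy gtr0_sg// mul1e /= mulr0.
Qed.

(* The integrand is dominated near q by means of x <= e^x for x = q k(v) / 4. *)
Lemma is_derive_laplace (R : realType) (W k : R -> R) (q : R) :
  measurable_fun setT k ->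
  (forall v, 0 <= W v) -> (forall v, 0 <= k v) ->
  (forall q, 0 < q ->
    lebesgue_measure.-integrable setT
      (EFin \o (fun v => W v * expR (- (q * k v))))) ->
  0 < q ->
  is_derive q (1 : R)
    (fun q => \int[lebesgue_measure]_v (W v * expR (- (q * k v))))
    (- \int[lebesgue_measure]_v (k v * W v * expR (- (q * k v)))).
Proof.
move=> mk W0 k0 intW q0.
pose f q v := W v * expR (- (q * k v)).
(* For r > q/2 the exponential is at most e^(-qk/2); half of this exponent absorbs the factor k,
   through k <= (4/q) e^(qk/4). *)
pose G v := (2 / q) * (2 * (W v * expR (- ((q / 4) * k v)))).
have q4 : 0 < q / 4 by rewrite divr_gt0.
have df (r v : R) : is_derive r (1 : R) (f ^~ v)
  (- (k v * W v * expR (- (r * k v)))).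
  apply: is_derive_eq; rewrite /GRing.scale/=; ring.
have Iq : `]q / 2, q * 2[%classic q.
  by rewrite /= in_itv/=; apply/andP; split; lra.
have intf (r : R) : `]q / 2, q * 2[%classic r ->
    lebesgue_measure.-integrable setT (EFin \o f r).
  by rewrite /= in_itv/= => /andP[qr _]; apply: intW; lra.
have G0 (v : R) : 0 <= G v.
  by rewrite /G !mulr_ge0 ?invr_ge0 ?expR_ge0 ?W0 // ltW.
have intG : lebesgue_measure.-integrable setT (EFin \o G).
  rewrite (_ : EFin \o G =
      fun v => ((2 / q * 2)%:E * (W v * expR (- ((q / 4) * k v)))%:E)%E).
    by apply: integrableZl => //; exact: intW.
  by apply/funext => v; rewrite /G /= -EFinM; congr EFin; ring.
have dG (r v : R) :
  `]q / 2, q * 2[%classic r -> setT v -> `|partial1of2 f r v| <= G v.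
  rewrite /= in_itv/= => /andP[qr _] _.
  rewrite partial1of2E (@derive_val _ _ _ _ _ _ _ (df r v)) normrN.
  rewrite ger0_norm ?mulr_ge0 ?expR_ge0// /G.
  have := expR_ge1Dx (q / 4 * k v).
  have kr : expR (- (r * k v)) <= expR (- (q / 2 * k v)).
    by rewrite ler_expR lerN2 ler_wpM2r// ltW.
  have -> : - (q / 4 * k v) = q / 4 * k v - (q / 2 * k v) by field.
  rewrite expRD.
  set e1 := expR (q / 4 * k v); set e2 := expR (- (q / 2 * k v)) => h.
  have e2_0 : 0 <= e2 by exact: expR_ge0.
  apply: (@le_trans _ _ (k v * W v * e2)); first by rewrite ler_wpM2l ?mulr_ge0.
  have -> : 2 / q * (2 * (W v * (e1 * e2))) = (4 / q * e1) * (W v * e2).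
    by field; rewrite gt_eqF.
  have -> : k v * W v * e2 = k v * (W v * e2) by ring.
  rewrite ler_wpM2r ?mulr_ge0// mulrAC ler_pdivlMr//; lra.
have dfd (r v : R) :
  `]q / 2, q * 2[%classic r -> setT v -> derivable (f ^~ v) r 1.
  by move=> _ _; exact: ex_derive.
have D := derivable_under_integral measurableT Iq intf dfd G0 intG dG.
have E := differentiation_under_integral measurableT Iq intf dfd G0 intG dG.
apply: DeriveDef => //.
rewrite -derive1E E.
transitivity (\int[lebesgue_measure]_v (-1 * (k v * W v * expR (- (q * k v))))).
  by apply: eq_Rintegral => v _; rewrite partial1of2E derive_val mulN1r.
rewrite RintegralZl ?mulN1r//.
apply: (le_integrable measurableT _ _ intG) => /=.
  apply/measurable_EFinP.
  rewrite (_ : (fun _ => _) = (fun v => k v * (W v * expR (- (q * k v))))).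
    apply: measurable_funM => //; apply/measurable_EFinP.
    exact: measurable_int (intW _ q0).
  by apply/funext => v; rewrite mulrA.
move=> v _; rewrite lee_fin [leRHS]ger0_norm//; apply: le_trans (dG q v Iq I).
by rewrite partial1of2E derive_val normrN.
Qed.

(** * Derivatives and recurrences of the integral, and its links with Gamma and K_nu *)

Section gig_calculus.
Variable R : realType.
Implicit Types a p y v c : R.

(** The derivative brings down e^(-v), which lowers the order by one; for Bessel functions this is
    (t^nu K_nu)' = - t^nu K_(nu-1). *)
Lemma is_derive_gig_y a p y : 0 < p -> 0 < y ->
  is_derive y 1 (gig a p) (- gig (a - 1) p y).
Proof.
move=> p0 y0.
pose W v := expR (a * v - p * expR v).
have E : gig a p = fun y => \int[lebesgue_measure]_v
  (W v * expR (- (y * expR (- v)))).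
  apply/funext => z; apply: eq_Rintegral => v _.
  by rewrite /gig_kernel expRD.
rewrite E.
have -> : gig (a - 1) p y =
    \int[lebesgue_measure]_v (expR (- v) * W v * expR (- (y * expR (- v)))).
  apply: eq_Rintegral => v _.
  by rewrite gig_kernelDl mulN1r -mulrA /gig_kernel expRD.
apply: is_derive_laplace => //.
- apply: continuous_measurable_fun => v; apply: continuous_comp.
    exact: opp_continuous.
  exact: continuous_expR.
- by move=> v; exact: expR_ge0.
- move=> z z0; apply: eq_integrable
    (integrable_gig_kernel R a p z p0 (ltW z0) _) => //.
    by move=> v _; rewrite /= /gig_kernel expRD.
  by rewrite z0.
Qed.

Lemma is_derive_gig_p a p y : 0 < p -> 0 <= y -> (0 < y) || (0 < a) ->
  is_derive p 1 (fun p => gig a p y) (- gig (a + 1) p y).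
Proof.
move=> p0 y0 ya.
pose W v := expR (a * v - y * expR (- v)).
have E : (fun p => gig a p y) = fun p => \int[lebesgue_measure]_v
  (W v * expR (- (p * expR v))).
  apply/funext => z; apply: eq_Rintegral => v _.
  by rewrite /gig_kernel -expRD; congr expR; ring.
rewrite E.
have -> : gig (a + 1) p y =
    \int[lebesgue_measure]_v (expR v * W v * expR (- (p * expR v))).
  apply: eq_Rintegral => v _.
  rewrite gig_kernelDl mul1r -mulrA; congr (_ * _).
  rewrite -expRD; congr expR.
  ring.
apply: is_derive_laplace => //.
- by move=> v; exact: expR_ge0.
- move=> z z0; apply: eq_integrable
    (integrable_gig_kernel R a z y z0 y0 ya) => //.
  by move=> v _; rewrite /= /gig_kernel -expRD; congr (expR _)%:E; ring.
Qed.

(** The shift of v by c, that is, u replaced by u e^c. The scaling rules below are choices of c. *)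
Lemma gig_translation a p y c :
  gig a p y = expR (a * c) * gig a (p * expR c) (y * expR (- c)).
Proof.
rewrite /gig /Rintegral (ge0_integral_translation R c)//; last 2 first.
- apply/measurable_EFinP; apply: continuous_measurable_fun.
  exact: continuous_gig_kernel.
- by move=> v _; rewrite lee_fin ltW// gig_kernel_gt0.
rewrite (_ : [set x | _] = setT)//.
rewrite (_ : (\int[_]_(_ in _) _)%E = (\int[lebesgue_measure]_v
    ((expR (a * c))%:E * (gig_kernel a (p * expR c) (y * expR (- c)) v)%:E))%E).
  rewrite ge0_integralZl//.
  - by rewrite fine_scale ?expR_gt0.
  - apply/measurable_EFinP; apply: continuous_measurable_fun.
    exact: continuous_gig_kernel.
  - by move=> v _; rewrite lee_fin ltW// gig_kernel_gt0.
apply: eq_integral => v _; rewrite -EFinM /gig_kernel -expRD.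
congr (expR _)%:E; rewrite opprD (expRD v c) (expRD (- v) (- c)); ring.
Qed.

Lemma gig_scaling a p : 0 < p -> gig a p 0 = p `^ (- a) * gig a 1 0.
Proof.
move=> p0; rewrite (gig_translation a p 0 (- ln p)) mul0r expRN lnK ?posrE//.
by rewrite divff ?gt_eqF// /powR gt_eqF// mulrN mulNr.
Qed.

(** At y = t^2/4 the powers of t/2 cancel, leaving the Turan inequality for K_nu. *)
Lemma gig_turan a y : 0 < y ->
  gig a 1 y ^+ 2 <= gig (a - 1) 1 y * gig (a + 1) 1 y.
Proof.
move=> y0.
have [A B C] : [/\ 0 < gig (a - 1) 1 y, 0 < gig a 1 y & 0 < gig (a + 1) 1 y].
  by split; apply: gig_gt0; rewrite ?y0 ?ltW.
have int b : lebesgue_measure.-integrable setT (EFin \o gig_kernel b 1 y).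
  by apply: integrable_gig_kernel; rewrite ?y0 ?ltW.
(* Cauchy-Schwarz through the discriminant of a quadratic in t. *)
have h (t : R) : 2 * t * gig a 1 y <= gig (a - 1) 1 y + t ^+ 2 * gig
  (a + 1) 1 y.
  have i1 := int (a - 1).
  have i2 : lebesgue_measure.-integrable setT
    (EFin \o (fun v => t ^+ 2 * gig_kernel (a + 1) 1 y v)).
    by apply: (integrableZl measurableT (t ^+ 2) (int (a + 1))).
  rewrite /gig -!RintegralZl// -RintegralD//.
  apply: le_Rintegral => //.
  - by apply: (integrableZl measurableT (2 * t) (int a)).
  - exact: (integrableD measurableT i1 i2).
  - move=> v _; rewrite !gig_kernelDl mul1r mulN1r.
    rewrite mulrA -mulrDl ler_pM2r ?gig_kernel_gt0//.
    rewrite -subr_ge0.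
    have -> : expR (- v) + t ^+ 2 * expR v - 2 * t =
        expR (- v) * (1 - t * expR v) ^+ 2.
      by rewrite expRN; field; rewrite gt_eqF ?expR_gt0.
    by rewrite mulr_ge0 ?expR_ge0 ?sqr_ge0.
(* This t minimises the quadratic. *)
have := h (gig a 1 y / gig (a + 1) 1 y).
set x := gig a 1 y in B *; set z := gig (a + 1) 1 y in C *.
have -> : 2 * (x / z) * x = 2 * (x ^+ 2 / z) by ring.
have -> : (x / z) ^+ 2 * z = x ^+ 2 / z by field; rewrite gt_eqF.
move=> {}h; rewrite -ler_pdivrMr//; lra.
Qed.

Lemma GammaE a : Gamma a = gig a 1 0.
Proof.
rewrite /Gamma /gig /Rintegral; congr fine.
rewrite (ge0_integral_expR_subst R (fun t => t `^ (a - 1) * expR (- t))).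
- apply: eq_integral => v _; rewrite /powR gt_eqF ?expR_gt0// expRK.
  by rewrite /gig_kernel -!expRD; congr (expR _)%:E; ring.
- move=> t; rewrite in_itv/= andbT => t0;
  have c1 : {for t, continuous (fun t : R => t `^ (a - 1))}.
    by apply: derivable_continuous; apply: derivable_powR; rewrite in_itv/= t0.
  have c2 : {for t, continuous (fun t : R => expR (- t))}.
    by apply: continuous_comp; [exact: opp_continuous|exact: continuous_expR].
  exact: (cvgM c1 c2).
- by move=> t t0; rewrite mulr_ge0 ?powR_ge0 ?expR_ge0.
Qed.

Lemma Gamma_gt0 a : 0 < a -> 0 < Gamma a.
Proof. by move=> a0; rewrite GammaE gig_gt0// a0 orbT. Qed.

(* Instead of integrating by parts, differentiate the scaling relation
   gig a p y = p^(-a) gig a 1 (p y) at p = e^0. *)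
Lemma gig_recurrence a y : 0 <= y -> (0 < y) || (0 < a) ->
  gig (a + 1) 1 y = a * gig a 1 y + y * gig (a - 1) 1 y.
Proof.
move=> y0 ya.
have E : (fun p => gig a p y) \o expR =
    fun q => expR (- a * q) * gig a 1 (y * expR q).
  apply/funext => q /=; rewrite (gig_translation a (expR q) y (- q)) opprK.
  by rewrite -expRD subrr expR0 mulrN mulNr.
have d1 : is_derive (0 : R) 1 ((fun p => gig a p y) \o expR)
    (- gig (a + 1) 1 y * expR 0).
  apply: is_derive1_comp.
  by rewrite expR0; exact: is_derive_gig_p.
have d2 : is_derive (0 : R) 1 (fun q => gig a 1 (y * expR q))
    (- y * gig (a - 1) 1 y).
  (* The case y = 0, which yields the functional equation of Gamma, is separate: [is_derive_gig_y]
     requires y > 0, but here y e^q stays at 0. *)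
  have [y_0|y_0] := eqVneq y 0.
    rewrite y_0; under eq_fun do rewrite mul0r.
    by rewrite oppr0 mul0r; exact: is_derive_cst.
  have -> : - y * gig (a - 1) 1 y = - gig (a - 1) 1 (y * expR 0) * (y * expR 0).
    by rewrite expR0 mulr1; ring.
  apply: (@is_derive1_comp _ (gig a 1) (fun q => y * expR q)).
    by apply: is_derive_gig_y => //; rewrite expR0 mulr1 lt_neqAle eq_sym y_0.
have d3 : is_derive (0 : R) 1 (fun q => expR (- a * q) * gig a 1 (y * expR q))
    (- y * gig (a - 1) 1 y - a * gig a 1 y).
  apply: is_derive_eq; rewrite /GRing.scale/= !mulr0 !expR0 mulr1; ring.
rewrite E in d1.
have := @derive_val _ _ _ _ _ _ _ d1.
rewrite (@derive_val _ _ _ _ _ _ _ d3) expR0 mulr1 => h.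
lra.
Qed.

Lemma GammaS a : 0 < a -> Gamma (a + 1) = a * Gamma a.
Proof. by move=> a0; rewrite !GammaE gig_recurrence ?a0 ?orbT// mul0r addr0.
  Qed.

(** The shift by ln Y balances the coefficients of e^v and e^(-v), so that the exponent contains -
    2Y cosh v. *)
Lemma gig_sqrE a Y : 0 < Y -> gig a 1 (Y ^+ 2) = Y `^ a * gig a Y Y.
Proof.
move=> Y0; rewrite (gig_translation a 1 (Y ^+ 2)
  (ln Y)) mul1r expRN lnK ?posrE//.
have -> : Y ^+ 2 / Y = Y by field; rewrite gt_eqF.
by rewrite /powR gt_eqF.
Qed.

(** Folding the line at 0 adds the kernels at v and -v, which gives 2 cosh(av) e^(-2Y cosh v). *)
Lemma besselKE a Y : 0 < Y ->
  gig a 1 (Y ^+ 2) = 2 * Y `^ a * besselK a (2 * Y).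
Proof.
move=> Y0.
rewrite gig_sqrE// (mulrC 2) -mulrA; congr (_ * _).
have cK b : continuous (gig_kernel b Y Y) by exact: continuous_gig_kernel.
have mK b : measurable_fun setT (fun v => (gig_kernel b Y Y v)%:E).
  by apply/measurable_EFinP; exact: continuous_measurable_fun.
pose F v := expR (- (2 * Y * cosh v)) * cosh (a * v).
have cF : continuous F.
  have -> : F = fun v => 2^-1 * (gig_kernel a Y Y v + gig_kernel a Y Y (- v)).
    apply/funext => v; rewrite /F /cosh /gig_kernel opprK.
    rewrite mulrA [RHS]mulrC; congr (_ / _).
    rewrite mulrDr -!expRD; congr (_ + _); congr expR; by field.
  move=> v; apply: cvgM; first exact: cvg_cst.
  apply: cvgD; first exact: cK.
  by apply: continuous_comp; [exact: opp_continuous|exact: cK].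
have F0 v : 0 <= F v.
  by rewrite mulr_ge0 ?expR_ge0// /cosh divr_ge0// addr_ge0 ?expR_ge0.
rewrite -fine_scale// /gig /besselK /Rintegral; congr fine.
rewrite ge0_integral_split0//; last first.
  by move=> v; rewrite lee_fin ltW// gig_kernel_gt0.
rewrite -ge0_integralD//; last 4 first.
- by move=> v _; rewrite lee_fin ltW// gig_kernel_gt0.
- by apply: measurable_funTS; exact: mK.
- by move=> v _; rewrite lee_fin ltW// gig_kernel_gt0.
- apply: measurable_funTS; apply/measurable_EFinP.
  apply: continuous_measurable_fun => v.
  by apply: continuous_comp; [exact: opp_continuous|exact: cK].
rewrite -[in RHS]integral_itv_obnd_cbnd; last first.
  by apply: measurable_funTS; apply/measurable_EFinP;
    exact: continuous_measurable_fun.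
rewrite -ge0_integralZl//; last first.
- by move=> v _; rewrite lee_fin F0.
- by apply: measurable_funTS; apply/measurable_EFinP;
    exact: continuous_measurable_fun.
apply: eq_integral => v _; rewrite -EFinD -EFinM; congr EFin.
rewrite /F /gig_kernel /cosh opprK [RHS]mulrC -mulrA divfK//.
rewrite mulrDr -!expRD; congr (_ + _); congr expR; by field.
Qed.

End gig_calculus.


(** * The power series of I_nu *)

(* Of the gamma function, only positivity and the functional equation matter. *)
Section bessel_series.
Variables (R : realType) (gam : R -> R).
Hypothesis gam_gt0 : forall a, 0 < a -> 0 < gam a.
Hypothesis gamS : forall a, 0 < a -> gam (a + 1) = a * gam a.
Implicit Types nu y : R.

Definition bessel_coef nu (k : nat) : R :=
  (k`!%:R * gam (nu + k%:R + 1))^-1.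

(** At y = (x/2)^2 this is (x/2)^(-nu) I_nu(x). Without the fractional power it is an entire
    function of y, differentiable also at y = 0. *)
Definition bessel_series nu y : R := limn (pseries (bessel_coef nu) y).

Lemma gam_shift_gt0 nu (k : nat) : -1 < nu -> 0 < gam (nu + k%:R + 1).
Proof.
move=> nu1; apply: gam_gt0.
by have : (0 : R) <= k%:R by []; lra.
Qed.

Lemma bessel_coef_gt0 nu k : -1 < nu -> 0 < bessel_coef nu k.
Proof. by move=> nu1; rewrite invr_gt0 mulr_gt0 ?gam_shift_gt0// ltr0n
  fact_gt0. Qed.

(** From index 1 on, each step multiplies by a factor above 1. The first step multiplies by nu + 1,
    possibly below 1, hence the minimum of two values. *)
Lemma gam_shift_ge nu : -1 < nu ->
  exists2 m : R, 0 < m & forall k : nat, m <= gam (nu + k%:R + 1).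
Proof.
move=> nu1; have G1 := gam_shift_gt0 nu 0 nu1; have G2 :=
  gam_shift_gt0 nu 1 nu1.
exists (Num.min (gam (nu + 0%:R + 1)) (gam (nu + 1%:R + 1))).
  by rewrite lt_min G1.
case=> [|k]; first by rewrite ge_min lexx.
rewrite ge_min; apply/orP; right.
elim: k => [//|k IH]; apply: (le_trans IH).
have k0 : (0 : R) <= k%:R by [].
have -> : nu + k.+2%:R + 1 = (nu + k.+1%:R + 1) + 1 by rewrite -[in LHS]natr1;
  ring.
rewrite (gamS (nu + k.+1%:R + 1)); last by rewrite -natr1; lra.
rewrite ler_peMl ?(ltW (gam_shift_gt0 _ _ _))//.
by rewrite -natr1; lra.
Qed.

(** Comparison with m^(-1) times the exponential series at |y|. *)
Lemma cvg_bessel_series nu y : -1 < nu -> cvgn (pseries (bessel_coef nu) y).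
Proof.
move=> nu1; have [m m0 mG] := gam_shift_ge nu nu1.
apply: normed_cvg.
apply: (@series_le_cvg _ _ (m^-1 *: exp_coeff `|y|)).
- by move=> n /=.
- by move=> n; rewrite /= mulr_ge0 ?invr_ge0 ?(ltW m0)// exp_coeff_ge0.
- move=> n /=; rewrite normrM normrX gtr0_norm ?bessel_coef_gt0//.
  rewrite exp_coeffE [leRHS]/GRing.scale/= [leRHS]mulrA ler_wpM2r ?exprn_ge0//.
  rewrite /bessel_coef invfM mulrC ler_wpM2r ?invr_ge0//.
  by rewrite lef_pV2 ?posrE ?mG// gam_shift_gt0.
- by apply: is_cvg_seriesZ; exact: is_cvg_series_exp_coeff.
Qed.

(** The factor k + 1 cancels against (k+1)! and the index shift passes into nu: this is (x^(-nu)
    I_nu)' = x^(-nu) I_(nu+1). *)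
Lemma bessel_coef_diffs nu : pseries_diffs (bessel_coef nu) = bessel_coef
  (nu + 1).
Proof.
apply/funext => k; rewrite /pseries_diffs /bessel_coef factS natrM.
rewrite -mulrA invfM mulVKf ?pnatr_eq0//.
by congr (_ * gam _)^-1; rewrite -[in LHS]natr1; ring.
Qed.

Lemma is_derive_bessel_series nu y : -1 < nu ->
  is_derive y 1 (bessel_series nu) (bessel_series (nu + 1) y).
Proof.
move=> nu1; rewrite /bessel_series -bessel_coef_diffs.
apply: (@pseries_snd_diffs _ _ (`|y| + 1)).
- exact: cvg_bessel_series.
- by rewrite bessel_coef_diffs; apply: cvg_bessel_series; lra.
- by rewrite !bessel_coef_diffs; apply: cvg_bessel_series; lra.
- by rewrite (ger0_norm (_ : 0 <= `|y| + 1))// ltrDl.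
Qed.

Lemma bessel_series_gt0 nu y : -1 < nu -> 0 <= y -> 0 < bessel_series nu y.
Proof.
move=> nu1 y0; apply: (@lt_le_trans _ _ (bessel_coef nu 0)).
  exact: bessel_coef_gt0.
have -> : bessel_coef nu 0 = pseries (bessel_coef nu) y 1.
  by rewrite /pseries /series /= big_nat1 expr0 mulr1.
apply: nondecreasing_cvgn_le; last exact: cvg_bessel_series.
apply/nondecreasing_seqP => n; rewrite /pseries /series /= big_nat_recr//=.
by rewrite lerDl mulr_ge0 ?exprn_ge0// ltW// bessel_coef_gt0.
Qed.

Lemma bessel_series0 nu : bessel_series nu 0 = (gam (nu + 1))^-1.
Proof.
apply/cvg_lim => //; rewrite -cvg_shiftS.
apply: cvg_near_cst; near=> n => /=.
rewrite /pseries /series /= big_nat_recl// big1 => [|i _].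
  by rewrite addr0 expr0 mulr1 /bessel_coef fact0 mul1r addr0.
by rewrite expr0n mulr0.
Unshelve. all: end_near. Qed.

(** As differentiation raises nu by one, this is the equation G = y G'' + (nu+1) G', or I_nu -
    I_(nu+2) = (2(nu+1)/x) I_(nu+1). It holds coefficient by coefficient. *)
Lemma bessel_series_ode nu y : -1 < nu ->
  bessel_series nu y = y * bessel_series (nu + 2) y + (nu + 1) * bessel_series
    (nu + 1) y.
Proof.
move=> nu1.
have k_eq k : bessel_coef nu k.+1 =
    (nu + 1) * bessel_coef (nu + 1) k.+1 + bessel_coef (nu + 2) k.
  have k0 : (0 : R) <= k%:R by [].
  rewrite /bessel_coef factS natrM.
  have -> : nu + 1 + k.+1%:R + 1 = (nu + k.+1%:R + 1) + 1 by ring.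
  have -> : nu + 2 + k%:R + 1 = (nu + k.+1%:R + 1) + 1 by rewrite -natr1; ring.
  rewrite (gamS (nu + k.+1%:R + 1)); last by rewrite -natr1; lra.
  have G0 := gam_shift_gt0 nu k.+1 nu1.
  have f0 : (0 : R) < k`!%:R by rewrite ltr0n fact_gt0.
  move: (gam _) G0 (k`!%:R) f0 => G G0 f f0; rewrite -natr1.
  field; rewrite !gt_eqF//; lra.
(* The factor y raises degrees by one, so the series of order nu + 2 is cut one term earlier. *)
have S n : pseries (bessel_coef nu) y n.+1 =
    y * pseries (bessel_coef (nu + 2)) y n +
    (nu + 1) * pseries (bessel_coef (nu + 1)) y n.+1.
  elim: n => [|n IH]; rewrite /pseries /series /=.
    rewrite big_nil !big_nat1 expr0 !mulr1 mulr0 add0r /bessel_coef fact0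
      !mul1r !addr0.
    rewrite (gamS (nu + 1)); last lra.
    have := gam_shift_gt0 nu 0 nu1; rewrite addr0.
    move: (gam _) => G G0; field; rewrite !gt_eqF//; lra.
  rewrite big_nat_recr//= [in RHS]big_nat_recr//=.
  rewrite [X in _ = _ + _ * X]big_nat_recr//=.
  move: IH; rewrite /pseries /series /= => ->.
  by rewrite k_eq exprS; ring.
have c0 : pseries (bessel_coef nu) y n.+1 @[n --> \oo] --> bessel_series nu y.
  by rewrite cvg_shiftS; exact: cvg_bessel_series.
have c1 : pseries (bessel_coef (nu + 1)) y n.+1 @[n --> \oo] --> bessel_series
  (nu + 1) y.
  by rewrite cvg_shiftS; apply: cvg_bessel_series; lra.
have c2 : pseries (bessel_coef (nu + 2)) y n @[n --> \oo] --> bessel_series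
  (nu + 2) y.
  by apply: cvg_bessel_series; lra.
have c3 : y * pseries (bessel_coef (nu + 2)) y n +
    (nu + 1) * pseries (bessel_coef (nu + 1)) y n.+1 @[n --> \oo] -->
    y * bessel_series (nu + 2) y + (nu + 1) * bessel_series (nu + 1) y.
  apply: cvgD.
    by apply: cvgM; [exact: cvg_cst|exact: c2].
  by apply: cvgM; [exact: cvg_cst|exact: c1].
rewrite (eq_cvg _ _ S) in c0.
exact: cvg_unique c0 c3.
Qed.

(* The difference T of the two sides satisfies T(0) < 0 and, by the ODE,
   y T' + (nu + 1/2) T = - (nu + 1/2) G G' / 2 <= 0, so y^(nu + 1/2) T is
   nonincreasing. *)
Lemma bessel_series_riccati nu y : - 2^-1 < nu -> 0 <= y ->
  y * bessel_series (nu + 1) y ^+ 2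
  + (nu + 2^-1) * bessel_series nu y * bessel_series (nu + 1) y
  <= bessel_series nu y ^+ 2.
Proof.
move=> nu1 y0.
pose G := bessel_series nu; pose G1 := bessel_series (nu + 1).
pose T z := z * G1 z ^+ 2 + (nu + 2^-1) * G z * G1 z - G z ^+ 2.
suff : T y <= 0 by rewrite /T subr_le0.
have dG z : is_derive z (1 : R) G (G1 z).
  by apply: is_derive_bessel_series; lra.
have dG1 z : is_derive z (1 : R) G1 (bessel_series (nu + 2) z).
  have -> : nu + 2 = nu + 1 + 1 by ring.
  by apply: is_derive_bessel_series; lra.
have ode z : G z = z * bessel_series (nu + 2) z + (nu + 1) * G1 z.
  by apply: bessel_series_ode; lra.
pose T' z := G1 z ^+ 2 + 2 * z * G1 z * bessel_series (nu + 2) z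
  + (nu + 2^-1) * (G1 z ^+ 2 + G z * bessel_series (nu + 2) z) - 2 * G z * G1 z.
have dT z : is_derive z (1 : R) T (T' z).
  by apply: is_derive_eq; rewrite /T' /GRing.scale/=; ring.
have eT z : z * T' z + (nu + 2^-1) * T z = - ((nu + 2^-1) / 2 * (G z * G1 z)).
  rewrite /T' /T ode; move: (bessel_series (nu + 2) z) (G1 z) => g2 g1;
    by field.
(* At 0 the ODE reads G = (nu+1) G', so T(0) = - (nu+1) G'(0)^2 / 2. *)
have T0 : T 0 < 0.
  have g0 : 0 < G1 0 by apply: bessel_series_gt0 => //; lra.
  by rewrite /T ode; move: (G1 0) g0 => g g0; nra.
have cT : continuous T.
  by move=> w; apply: derivable_continuous; exact:
    (@ex_derive _ _ _ _ _ _ _ (dT w)).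
rewrite leNgt; apply/negP => Ty.
have {y0} y0 : 0 < y.
  by rewrite lt_neqAle y0 andbT; apply/eqP => e; move: Ty; rewrite -e ltNge ltW.
(* The weight z^(nu+1/2) vanishes at 0 and need not be differentiable there; the comparison starts
   at some e > 0 where T is still negative by continuity. *)
have [e [e0 ey Te]] : exists e, [/\ 0 < e, e <= y & T e < 0].
  apply: (@filter_ex _ ((0 : R)^'+)); near=> z; split.
  - by near: z; exact: nbhs_right_gt.
  - by near: z; exact: nbhs_right_le.
  - by near: z; exact: (cvgr_lt _ (cvg_at_right_filter (cT 0))).
pose U z := z `^ (nu + 2^-1) * T z.
have dU (z : R) : 0 < z -> is_derive z (1 : R) U
    (z `^ (nu + 2^-1 - 1) * ((nu + 2^-1) * T z + z * T' z)).
  move=> z0; have dp := is_derive1_powR (nu + 2^-1) z0.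
  apply: is_derive_eq; rewrite /GRing.scale/=.
  by rewrite -(mulr_powRB1 (ltW z0) (_ : 0 < nu + 2^-1)); [ring|lra].
have UU : U y <= U e.
  apply: (@ler0_derive1_le_cc _ U e y) => //.
  - by move=> z; rewrite in_itv/= => /andP[ez _]; exact:
      (@ex_derive _ _ _ _ _ _ _ (dU z (lt_trans e0 ez))).
  - move=> z; rewrite in_itv/= => /andP[ez _]; have z0 := lt_trans e0 ez.
    rewrite derive1E (@derive_val _ _ _ _ _ _ _ (dU z z0)) [X in _ * X]addrC eT.
    rewrite mulrN oppr_le0 mulr_ge0 ?powR_ge0// mulr_ge0//; first lra.
    by rewrite mulr_ge0// ltW// bessel_series_gt0//; lra.
  - apply: derivable_within_continuous => z; rewrite in_itv/= => /andP[ez _].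
    exact: (@ex_derive _ _ _ _ _ _ _ (dU z (lt_le_trans e0 ez))).
  - by rewrite in_itv/= lexx ?ey.
  - by rewrite in_itv/= lexx ey.
have : 0 < U e by apply: lt_le_trans UU; rewrite mulr_gt0// powR_gt0.
by rewrite pmulr_rgt0 ?powR_gt0// ltNge ltW.
Unshelve. all: end_near. Qed.

End bessel_series.

Arguments bessel_coef {R} gam nu k.
Arguments bessel_series {R} gam nu y.

Lemma besselIE (R : realType) (nu x : R) : -1 < nu -> 0 < x ->
  besselI nu x = (x / 2) `^ nu * bessel_series (@Gamma R) nu ((x / 2) ^+ 2).
Proof.
move=> nu1 x0; rewrite /besselI /bessel_series.
rewrite -[RHS]/((x / 2) `^ nu *: limn
  (pseries (bessel_coef (@Gamma R) nu) ((x / 2) ^+ 2))).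
rewrite -lim_seriesZ; last exact:
  (cvg_bessel_series R _ (Gamma_gt0 R) (GammaS R)).
congr (limn (series _)); apply/funext => k /=.
rewrite powRD; last by apply/implyP => _; rewrite gt_eqF// divr_gt0.
rewrite powR_mulrn ?divr_ge0 ?ltW// exprM /bessel_coef.
by rewrite /GRing.scale/= -!mulrA; congr (_ * _); rewrite mulrC.
Qed.


(** * Monotonicity in x *)

Section monotonicity.
Variables (R : realType) (gam : R -> R).
Hypothesis gam_gt0 : forall a, 0 < a -> 0 < gam a.
Hypothesis gamS : forall a, 0 < a -> gam (a + 1) = a * gam a.
Implicit Types a nu X Y v x s : R.

(** The reflection of v, or u replaced by 1/u; on the diagonal p = y it gives K_(-a) = K_a. *)
Lemma gig_reflection a p y : gig (- a) y p = gig a p y.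
Proof.
rewrite /gig /Rintegral; congr fine.
transitivity (\int[lebesgue_measure]_v (gig_kernel (- a) y p (- v))%:E)%E.
  rewrite [LHS](ge0_integral_reflection R) => [//||| v _].
  - exact: measurableT.
  - apply/measurable_EFinP; apply: continuous_measurable_fun.
    exact: continuous_gig_kernel.
  - by rewrite lee_fin ltW// gig_kernel_gt0.
apply: eq_integral => v _; rewrite /gig_kernel opprK mulrNN.
by rewrite addrAC.
Qed.

(** The difference factors as (e^(bv) - e^(av)) (1 - e^(-(a+b)v)), and neither factor has sign
    opposite to v. *)
Lemma expR_sym_le a b v : `|a| <= b ->
  expR (a * v) + expR (- a * v) <= expR (b * v) + expR (- b * v).
Proof.
rewrite ler_norml => /andP[ba ab]; rewrite -subr_ge0.
have -> : expR (b * v) + expR (- b * v) - (expR (a * v) + expR (- a * v)) =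
    (expR (b * v) - expR (a * v)) * (1 - expR (- (a + b) * v)).
  rewrite mulrBl !mulrBr !mulr1 -!expRD.
  have -> : b * v + - (a + b) * v = - a * v by ring.
  have -> : a * v + - (a + b) * v = - b * v by ring.
  ring.
have ab0 : 0 <= a + b by lra.
have [v0|v0] := leP 0 v.
  apply: mulr_ge0; first by rewrite subr_ge0 ler_expR ler_wpM2r.
  by rewrite subr_ge0 -expR0 ler_expR mulNr oppr_le0 mulr_ge0.
apply: mulr_le0; first by rewrite subr_le0 ler_expR ler_wnM2r// ltW.
by rewrite subr_le0 -expR0 ler_expR mulNr oppr_ge0 mulr_ge0_le0// ltW.
Qed.

(** Averaging with the reflected integral replaces e^(cv) by cosh(cv), which grows with |c|. *)
Lemma gig_diag_le a b Y : 0 < Y -> `|a| <= b -> gig a Y Y <= gig b Y Y.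
Proof.
move=> Y0 ab.
have int c : lebesgue_measure.-integrable setT (EFin \o gig_kernel c Y Y).
  by apply: integrable_gig_kernel; rewrite ?Y0 ?ltW.
have dbl c : 2 * gig c Y Y =
    \int[lebesgue_measure]_v (gig_kernel c Y Y v + gig_kernel (- c) Y Y v).
  by rewrite RintegralD// -/(gig c Y Y) -/(gig (- c) Y Y) gig_reflection; ring.
rewrite -(ler_pM2l (_ : 0 < 2))// !dbl; apply: le_Rintegral => //.
- exact: (integrableD measurableT (int a) (int (- a))).
- exact: (integrableD measurableT (int b) (int (- b))).
move=> v _.
have fac c : gig_kernel c Y Y v = expR (c * v) * gig_kernel 0 Y Y v.
  by rewrite -gig_kernelDl add0r.
rewrite !(fac a) !(fac b) (fac (- a)) (fac (- b)) -!mulrDl.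
by rewrite ler_pM2r ?gig_kernel_gt0// expR_sym_le.
Qed.

(** After cancelling Y^nu this is K_nu <= K_(1-nu) = K_(nu-1), where |nu| <= 1 - nu because nu <
    1/2. *)
Lemma gig_ratio_ge1 nu Y : 0 < Y -> `|nu| < 2^-1 ->
  gig nu 1 (Y ^+ 2) <= Y * gig (nu - 1) 1 (Y ^+ 2).
Proof.
move=> Y0 nu1; rewrite !gig_sqrE// mulrA.
have -> : Y * Y `^ (nu - 1) = Y `^ nu.
  have -> : Y `^ (nu - 1) = Y `^ nu / Y `^ 1.
    by apply: powRB; apply/implyP => _; rewrite gt_eqF.
  by rewrite powRr1 ?ltW// mulrCA divff ?gt_eqF// mulr1.
rewrite ler_pM2l ?powR_gt0//.
rewrite -(gig_reflection (nu - 1)); apply: gig_diag_le => //.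
by move: nu1; rewrite ltr_norml ler_norml => /andP[]; lra.
Qed.

(* With x = 2X and t = 2Y, this compares the logarithmic derivatives of
   x^(-nu) I_nu(x) and t^nu K_nu(t). *)
Lemma bessel_logderiv_le nu X Y :
  2^-1 <= nu \/ `|nu| < 2^-1 -> 0 <= X -> X <= Y -> 0 < Y ->
  X * bessel_series gam (nu + 1) (X ^+ 2) * gig nu 1 (Y ^+ 2) <=
  bessel_series gam nu (X ^+ 2) * (Y * gig (nu - 1) 1 (Y ^+ 2)).
Proof.
move=> hnu X0 XY Y0.
have nu0 : - 2^-1 < nu.
  by case: hnu => [|/ltr_normlP[]]; lra.
have X2 : 0 <= X ^+ 2 by rewrite sqr_ge0.
have Y2 : 0 < Y ^+ 2 by rewrite exprn_gt0.
have := bessel_series_riccati R gam gam_gt0 gamS nu (X ^+ 2) nu0 X2.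
have := bessel_series_gt0 R gam gam_gt0 gamS nu (X ^+ 2); move=>
  /(_ (ltac:(lra)) X2).
have := bessel_series_gt0 R gam gam_gt0 gamS (nu + 1) (X ^+ 2); move=>
  /(_ (ltac:(lra)) X2).
have hp a : 0 < gig a 1 (Y ^+ 2) by apply: gig_gt0; rewrite ?Y2 ?ltW.
have := hp nu; have := hp (nu - 1).
have turan := gig_turan R nu (Y ^+ 2) Y2.
rewrite gig_recurrence ?Y2 ?(ltW Y2)// in turan.
have ratio := gig_ratio_ge1 nu Y Y0.
move: (bessel_series gam nu _) (bessel_series gam (nu + 1) _) =>
  G G1 in turan ratio *.
move: (gig nu 1 _) (gig (nu - 1) 1 _) turan ratio =>
  h h1 turan ratio h1_0 h0 G1_0 G0 ric.
have A0 : 0 <= X * G1 by rewrite mulr_ge0// ltW.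
case: hnu => hnu; last first.
  have hle := ratio hnu.
  have GX : X * G1 <= G.
    rewrite -(ler_pXn2r (_ : 0 < 2)%N) ?nnegrE ?(ltW G0)//.
    rewrite exprMn (le_trans _ ric)// lerDl -mulrA mulr_ge0//; first lra.
    by rewrite mulr_ge0 ?ltW.
  by apply: ler_pM => //; exact: ltW.
(* Suppose X G1 h > G Y h1. As X <= Y, also G h1 < G1 h. Chaining the Riccati bound [r1] with the
   Turan bound [r2] then gives (1/2) (G h) (G1 h) < 0, which is absurd. *)
rewrite leNgt; apply/negP => lt.
have B0 : 0 < G * (Y * h1) by rewrite !mulr_gt0.
have Xpos : 0 < X.
  rewrite lt_neqAle X0 andbT; apply/eqP => e; move: lt.
  by rewrite -e !mul0r ltNge ltW.
have gh : G * h1 < G1 * h.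
  rewrite -(ltr_pM2l Xpos); apply: le_lt_trans (_ : _ <= G * (Y * h1)) _.
    by rewrite mulrCA ler_pM2l// ler_pM2r.
  by rewrite [ltRHS]mulrA.
have sq : (G * (Y * h1)) ^+ 2 < (X * G1 * h) ^+ 2.
  by rewrite ltr_pXn2r// nnegrE ltW// (lt_trans B0).
have r1 : (X * G1 * h) ^+ 2 + (nu + 2^-1) * (G * h) * (G1 * h) <= (G * h) ^+ 2.
  have := ler_wpM2r (ltW (exprn_gt0 2 h0)) ric.
  by rewrite !exprMn; nra.
have r2 : (G * h) ^+ 2 <= nu * (G * h) * (G * h1) + (G * (Y * h1)) ^+ 2.
  have := ler_wpM2l (ltW (exprn_gt0 2 G0)) turan.
  by rewrite !exprMn; nra.
have r3 : nu * (G * h) * (G * h1) <= nu * (G * h) * (G1 * h).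
  by rewrite ler_wpM2l ?mulr_ge0 ?ltW//; lra.
have r4 : 0 <= 2^-1 * ((G * h) * (G1 * h)) by rewrite !mulr_ge0// ltW.
lra.
Qed.

(** The derivative is the difference compared in [bessel_logderiv_le] at X = x/2, Y = (x+s)/2.
    Taking s > 0 keeps Y positive even at x = 0. *)
Lemma bessel_product_nincr nu s x1 x2 :
  2^-1 <= nu \/ `|nu| < 2^-1 -> 0 < s -> 0 <= x1 -> x1 <= x2 ->
  bessel_series gam nu ((x2 / 2) ^+ 2) * gig nu 1 (((x2 + s) / 2) ^+ 2) <=
  bessel_series gam nu ((x1 / 2) ^+ 2) * gig nu 1 (((x1 + s) / 2) ^+ 2).
Proof.
move=> hnu s0 x10 x12.
have nu0 : - 2^-1 < nu.
  by case: hnu => [|/ltr_normlP[]]; lra.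
pose P x := bessel_series gam nu ((x / 2) ^+ 2) * gig nu 1 (((x + s) / 2) ^+ 2).
have dP x : 0 <= x -> is_derive x (1 : R) P
    (x / 2 * bessel_series gam (nu + 1) ((x / 2) ^+ 2) *
       gig nu 1 (((x + s) / 2) ^+ 2) -
     bessel_series gam nu ((x / 2) ^+ 2) *
       ((x + s) / 2 * gig (nu - 1) 1 (((x + s) / 2) ^+ 2))).
  move=> x0.
  have d1 : is_derive x (1 : R) (fun x => bessel_series gam nu ((x / 2) ^+ 2))
      (bessel_series gam (nu + 1) ((x / 2) ^+ 2) * (x / 2)).
    apply: (@is_derive1_comp _ (bessel_series gam nu) (fun x => (x / 2) ^+ 2)).
      by apply: is_derive_bessel_series => //; lra.
    by apply: is_derive_eq; rewrite /GRing.scale/=; field.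
  have d2 : is_derive x (1 : R) (fun x => gig nu 1 (((x + s) / 2) ^+ 2))
      (- gig (nu - 1) 1 (((x + s) / 2) ^+ 2) * ((x + s) / 2)).
    apply: (@is_derive1_comp _ (gig nu 1) (fun x => ((x + s) / 2) ^+ 2)).
      by apply: is_derive_gig_y => //; rewrite exprn_gt0// divr_gt0//; lra.
    by apply: is_derive_eq; rewrite /GRing.scale/=; field.
  by apply: is_derive_eq; rewrite /GRing.scale/=; ring.
rewrite -[leLHS]/(P x2) -[leRHS]/(P x1).
have [->//|ne] := eqVneq x1 x2.
apply: (@ler0_derive1_le_cc _ P x1 x2) => //.
- by move=> z; rewrite in_itv/= => /andP[ez _]; exact:
    (@ex_derive _ _ _ _ _ _ _ (dP z (ltW (le_lt_trans x10 ez)))).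
- move=> z; rewrite in_itv/= => /andP[ez _]; have z0 := ltW
    (le_lt_trans x10 ez).
  rewrite derive1E (@derive_val _ _ _ _ _ _ _ (dP z z0)) subr_le0.
  by apply: bessel_logderiv_le => //; lra.
- apply: derivable_within_continuous => z; rewrite in_itv/= => /andP[ez _].
  exact: (@ex_derive _ _ _ _ _ _ _ (dP z (le_trans x10 ez))).
- by rewrite in_itv/= lexx x12.
- by rewrite in_itv/= lexx x12.
Qed.

End monotonicity.


(** * The Laplace transform of t^nu K_nu(t) *)

(** Completing the square gives a multiple of the normal density with mean b/(2c) and variance
    1/(2c), whose mass is 1. *)
Lemma ge0_integral_gauss_linear (R : realType) (b c : R) : 0 < c ->
  (\int[lebesgue_measure]_s (expR (b * s - c * s ^+ 2))%:E =
   (Num.sqrt (pi / c) * expR (b ^+ 2 / (4 * c)))%:E)%E.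
Proof.
move=> c0.
pose sg := Num.sqrt (2 * c)^-1.
have sg2 : sg ^+ 2 = (2 * c)^-1 by rewrite sqr_sqrtr// invr_ge0 mulr_ge0// ltW.
have sg0 : sg != 0 by rewrite gt_eqF// sqrtr_gt0 invr_gt0 mulr_gt0.
pose m := b / (2 * c).
have E s : (expR (b * s - c * s ^+ 2))%:E =
    ((Num.sqrt (pi / c) * expR (b ^+ 2 / (4 * c)))%:E *
      (normal_pdf m sg s)%:E)%E.
  rewrite -EFinM; congr EFin;
    rewrite normal_pdfE// /normal_peak /normal_fun sg2.
  have -> : (2 * c)^-1 * pi *+ 2 = pi / c by rewrite -mulr_natr; field;
    rewrite gt_eqF.
  have q0 : 0 < Num.sqrt (pi / c) by rewrite sqrtr_gt0 divr_gt0// pi_gt0.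
  rewrite mulrACA divff ?gt_eqF// mul1r -expRD; congr expR;
    rewrite /m -mulr_natr; field; rewrite gt_eqF//.
under eq_integral do rewrite E.
rewrite ge0_integralZl//.
- by rewrite integral_normal_pdf// mule1.
- apply/measurable_EFinP; exact: measurable_normal_pdf.
- by move=> s _; rewrite lee_fin normal_pdf_ge0.
Qed.

Section laplace_of_gig.
Variable R : realType.
Implicit Types beta nu s v : R.

Definition gig_joint beta nu (z : R * R) : R :=
  expR (beta * z.1) * gig_kernel nu 1 ((z.1 / 2) ^+ 2) z.2.

Lemma measurable_gig_joint beta nu : measurable_fun setT (gig_joint beta nu).
Proof.
have mexp : measurable_fun setT (@expR R) by apply: continuous_measurable_fun;
  exact: continuous_expR.
have m1 : measurable_fun setT (fun z : R * R => z.1) by exact: measurable_fst.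
have m2 : measurable_fun setT (fun z : R * R => z.2) by exact: measurable_snd.
apply: measurable_funM.
  apply: measurableT_comp => //; apply: measurable_funM => //;
    exact: measurable_cst.
apply: measurableT_comp => //.
apply: measurable_funB; last first.
  apply: measurable_funM.
    apply: measurable_funX; apply: measurable_funM => //; exact: measurable_cst.
  apply: measurableT_comp => //; exact: measurable_funN.
apply: measurable_funB; apply: measurable_funM => //; try exact: measurable_cst.
by apply: measurableT_comp.
Qed.

Lemma measurable_gig_section beta nu :
  measurable_fun setT
    (fun s => \int[lebesgue_measure]_v (gig_joint beta nu (s, v))%:E)%E.
Proof.
apply: (@measurable_fun_fubini_tonelli_F _ _ _ _ _ lebesgue_measure
  (EFin \o gig_joint beta nu)).
- by apply/measurable_EFinP; exact: measurable_gig_joint.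
- by move=> z; rewrite lee_fin mulr_ge0 ?expR_ge0.
Qed.

(** At s = 0 and nu <= 0 the left side is infinite, while [gig] takes the default value 0. *)
Lemma gig_sectionE beta nu s : s != 0 ->
  (\int[lebesgue_measure]_v (gig_joint beta nu (s, v))%:E)%E =
  (expR (beta * s) * gig nu 1 ((s / 2) ^+ 2))%:E.
Proof.
move=> s0.
have s2 : 0 < (s / 2) ^+ 2 by rewrite exprn_even_gt0//= mulf_neq0// invr_eq0.
rewrite EFinM EFin_gig ?s2 ?(ltW s2)//.
rewrite -ge0_integralZl//.
- apply/measurable_EFinP; apply: continuous_measurable_fun.
  exact: continuous_gig_kernel.
- by move=> v _; rewrite lee_fin ltW// gig_kernel_gt0.
Qed.

(** By Tonelli, s is integrated first: the Gaussian with c = e^(-v)/4 yields 2 sqrt(pi) e^(v/2)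
    e^(beta^2 e^v). What remains in v is [gig] of order nu + 1/2 with p = 1 - beta^2 and y = 0, a
    scaled gamma integral. *)
Lemma ge0_integral_gig_joint beta nu : -1 < beta < 1 -> - 2^-1 < nu ->
  (\int[lebesgue_measure]_s \int[lebesgue_measure]_v
    (gig_joint beta nu (s, v))%:E =
   (2 * Num.sqrt pi * ((1 - beta ^+ 2) `^ (- (nu + 2^-1)) * Gamma
     (nu + 2^-1)))%:E)%E.
Proof.
move=> /andP[b1 b2] nu0.
have bb : 0 < 1 - beta ^+ 2 by nra.
transitivity (\int[lebesgue_measure]_v \int[lebesgue_measure]_s
    (gig_joint beta nu (s, v))%:E)%E.
  apply: (@fubini_tonelli _ _ _ _ _ lebesgue_measure lebesgue_measure
    (EFin \o gig_joint beta nu)).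
  - by apply/measurable_EFinP; exact: measurable_gig_joint.
  - by move=> z; rewrite lee_fin mulr_ge0 ?expR_ge0.
rewrite GammaE -gig_scaling// EFinM EFin_gig ?lexx//; last by apply/orP;
  right; lra.
rewrite -ge0_integralZl//; last first.
- by move=> v _; rewrite lee_fin ltW// gig_kernel_gt0.
- apply/measurable_EFinP; apply: continuous_measurable_fun.
  exact: continuous_gig_kernel.
apply: eq_integral => v _.
have ev : 0 < expR (- v) by exact: expR_gt0.
transitivity (\int[lebesgue_measure]_s ((expR (nu * v - expR v))%:E *
   (expR (beta * s - (expR (- v) / 4) * s ^+ 2))%:E))%E.
  apply: eq_integral => s _; rewrite -EFinM /= /gig_joint /gig_kernel -!expRD.
  by congr (expR _)%:E; rewrite /=; field.
rewrite ge0_integralZl//; last first.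
- apply/measurable_EFinP; apply: continuous_measurable_fun => s.
  apply: continuous_comp; last exact: continuous_expR.
  apply: cvgB; apply: cvgM; [exact: cvg_cst|exact: cvg_id|exact: cvg_cst|].
  exact: exprn_continuous.
rewrite ge0_integral_gauss_linear ?divr_gt0// -!EFinM; congr EFin.
have -> : pi / (expR (- v) / 4) = pi * (2 * expR (v / 2)) ^+ 2.
  rewrite exprMn -expRM_natl expRN.
  have -> : expR (2%:R * (v / 2)) = expR v by congr expR; field.
  by field; rewrite gt_eqF ?expR_gt0.
rewrite sqrtrM ?pi_ge0// sqrtr_sqr ger0_norm ?mulr_ge0 ?expR_ge0//.
rewrite /gig_kernel mul0r subr0.
have -> : beta ^+ 2 / (4 * (expR (- v) / 4)) = beta ^+ 2 * expR v.
  by rewrite expRN; field; rewrite gt_eqF ?expR_gt0.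
have -> : (nu + 2^-1) * v - (1 - beta ^+ 2) * expR v =
    (nu * v - expR v) + (v / 2 + beta ^+ 2 * expR v) by field.
by rewrite !expRD; ring.
Qed.

(** The line is split at 0; since H is even, reflecting the negative half only changes beta into -
    beta. *)
Lemma ge0_integral_gig_halves beta nu : -1 < beta < 1 -> - 2^-1 < nu ->
  (\int[lebesgue_measure]_(s in `]0%R, +oo[)
     (expR (beta * s) * gig nu 1 ((s / 2) ^+ 2))%:E +
   \int[lebesgue_measure]_(s in `]0%R, +oo[)
     (expR (- beta * s) * gig nu 1 ((s / 2) ^+ 2))%:E =
   (2 * Num.sqrt pi * ((1 - beta ^+ 2) `^ (- (nu + 2^-1)) * Gamma
     (nu + 2^-1)))%:E)%E.
Proof.
move=> b12 nu0; rewrite -ge0_integral_gig_joint//.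
rewrite [RHS]ge0_integral_split0; last 2 first.
- exact: measurable_gig_section.
- by move=> s; apply: integral_ge0 => v _; rewrite lee_fin mulr_ge0 ?expR_ge0.
congr (_ + _)%E; apply: eq_integral => s; rewrite inE/= in_itv/= andbT => s0.
  by rewrite gig_sectionE// gt_eqF.
rewrite gig_sectionE; last by rewrite oppr_eq0 gt_eqF.
by rewrite mulrN (mulNr s) sqrrN (mulNr beta).
Qed.

End laplace_of_gig.


(** * The bound *)

(** B extends f monotonically to 0. All values of f on x > 0 lie in [0, B 0], hence so does the
    limit, and the strict inequality survives because B 0 < D. *)
Lemma extend0_bound (R : realType) (f B : R -> R) (D : R) :
  (forall x, 0 < x -> f x = B x) -> (forall x, 0 <= x -> 0 <= B x) ->
  (forall x y, 0 <= x -> x <= y -> B y <= B x) -> B 0 < D ->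
  cvg (f y @[y --> 0^'+]) /\ forall x, 0 <= x -> `|extend0 f x| < D.
Proof.
move=> fB B0 mB BD.
have f0B x : 0 < x -> 0 <= f x <= B 0.
  by move=> x0; rewrite fB// B0 ?mB// ltW.
have cf : cvg (f y @[y --> 0^'+]).
  apply: nonincreasing_at_right_is_cvgr; near=> z.
    move=> x y; rewrite !in_itv/= => /andP[x0 _] /andP[y0 _] xy.
    by rewrite !fB// mB// ltW.
  exists (B 0) => _ [x /= + <-]; rewrite in_itv/= => /andP[x0 _].
  by have /andP[] := f0B x x0.
split => // x x0; rewrite /extend0; case: ifPn => [_|xn0].
  rewrite ger0_norm.
    apply: le_lt_trans BD; apply: limr_le => //; near=> z.
    have z0 : 0 < z by near: z; exact: nbhs_right_gt.
    by have /andP[] := f0B z z0.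
  apply: limr_ge => //; near=> z.
  have z0 : 0 < z by near: z; exact: nbhs_right_gt.
  by have /andP[] := f0B z z0.
have /andP[fx0 fxB] : 0 <= f x <= B 0 by apply: f0B;
  rewrite lt_neqAle eq_sym xn0.
by rewrite ger0_norm// (le_lt_trans fxB).
Unshelve. all: end_near. Qed.

Lemma lebesgue_integrableZl (R : realType) (i : interval R) (k : R)
  (f : R -> R) :
  lebesgue_measure.-integrable [set` i] (EFin \o f) ->
  lebesgue_measure.-integrable [set` i] (EFin \o (fun x => k * f x)).
Proof.
move=> intf.
have := integrableZl _ k intf; apply; exact: measurable_itv.
Qed.

Section shifted_laplace.
Variables (R : realType) (G H : R -> R) (b : R).
Hypothesis G_gt0 : forall x, 0 < G x.
Hypothesis H_gt0 : forall x, 0 < x -> 0 < H x.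
Hypothesis GH_nincr : forall s x y, 0 < s -> 0 <= x -> x <= y ->
  G y * H (y + s) <= G x * H (x + s).
Hypothesis intH : lebesgue_measure.-integrable `]0, +oo[
  (EFin \o (fun s => expR (b * s) * H s)).

(** The substitution t = x + s gives all x one common domain. It is open because H is controlled
    only at positive arguments. *)
Definition shifted_laplace (x : R) : R :=
  \int[lebesgue_measure]_(s in `]0, +oo[) (expR (b * s) * H (x + s)).

Lemma shifted_laplace_ge0 x : 0 <= x -> 0 <= shifted_laplace x.
Proof.
move=> x0; apply: Rintegral_ge0 => s; rewrite /= in_itv/= andbT => s0.
by rewrite mulr_ge0 ?expR_ge0// ltW// H_gt0// ltr_wpDl.
Qed.

(** Monotonicity between 0 and x bounds H(x+s) by (G(0)/G(x)) H(s), so integrability at 0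
    suffices. *)
Lemma integrable_shifted x : 0 <= x ->
  lebesgue_measure.-integrable `]0,
    +oo[ (EFin \o (fun s => expR (b * s) * H (x + s))).
Proof.
move=> x0.
have i := lebesgue_integrableZl R _ (G 0 / G x) _ intH.
apply: (le_integrable _ _ _ i); first exact: measurable_itv.
  apply/measurable_EFinP.
  (* Up to the constant e^(-bx), this is a translate of a function already known to be
     measurable. *)
  have -> : (fun s => expR (b * s) * H (x + s)) =
      (fun s => expR (- b * x) *
        ((fun s => expR (b * s) * H s) \o (fun s => x + s)) s).
    apply/funext => s /=; rewrite mulrA -expRD; congr (expR _ * _); ring.
  apply: measurable_funM; first exact: measurable_cst.
  have mH : measurable_fun (`]0, +oo[ : set R) (fun s => expR (b * s) * H s).
    by apply/measurable_EFinP; exact: measurable_int intH.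
  apply: (measurable_comp (measurable_itv `]0, +oo[) _ mH).
    by move=> _ [s /= + <-]; rewrite !in_itv/= !andbT => s0; rewrite ltr_wpDl.
  by apply: measurable_funD => //; exact: measurable_cst.
move=> s; rewrite /= in_itv/= andbT => s0.
have xs0 : 0 < x + s by rewrite ltr_wpDl.
have Hs := H_gt0 s s0; have Hxs := H_gt0 (x + s) xs0.
have G0 := G_gt0 0; have Gx := G_gt0 x.
have es := expR_gt0 (b * s).
rewrite lee_fin !gtr0_norm ?mulr_gt0 ?invr_gt0//.
rewrite mulrCA ler_pM2l// mulrAC ler_pdivlMr// mulrC.
by have := GH_nincr s 0 x s0 (lexx 0) x0; rewrite add0r.
Qed.

Lemma product_shifted_laplace_nincr x y : 0 <= x -> x <= y ->
  G y * shifted_laplace y <= G x * shifted_laplace x.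
Proof.
move=> x0 xy; have y0 := le_trans x0 xy.
have E z : 0 <= z -> G z * shifted_laplace z =
    \int[lebesgue_measure]_(s in `]0, +oo[) (expR (b * s) * (G z * H (z + s))).
  move=> z0; rewrite /shifted_laplace -RintegralZl//;
    last exact: integrable_shifted.
  by apply: eq_Rintegral => s _; rewrite mulrCA.
have int z : 0 <= z -> lebesgue_measure.-integrable `]0, +oo[
    (EFin \o (fun s => expR (b * s) * (G z * H (z + s)))).
  move=> z0.
  apply: eq_integrable (lebesgue_integrableZl R _ (G z) _
    (integrable_shifted z z0)) => //.
  by move=> s _; rewrite /= mulrCA.
rewrite !E//; apply: le_Rintegral => //; [exact: int|exact: int|].
move=> s; rewrite /= in_itv/= andbT => s0.
by rewrite ler_pM2l ?expR_gt0// GH_nincr.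
Qed.

End shifted_laplace.

Arguments shifted_laplace {R} H b x.

Section bessel_expr_bound.
Variables (R : realType) (beta nu : R).
Hypothesis hbeta : -1 < beta < 1.
Hypothesis hnu : 2^-1 <= nu \/ `|nu| < 2^-1.

Let G x : R := bessel_series (@Gamma R) nu ((x / 2) ^+ 2).
Let H x : R := gig nu 1 ((x / 2) ^+ 2).

Let nu0 : - 2^-1 < nu.
Proof. by case: hnu => [|/ltr_normlP[]]; lra. Qed.

Let G_gt0 x : 0 < G x.
Proof.
apply: bessel_series_gt0; [exact: Gamma_gt0|exact: GammaS| |exact: sqr_ge0].
by move: nu0; lra.
Qed.

Let H_gt0 x : 0 < x -> 0 < H x.
Proof.
move=> x0; have x2 : 0 < (x / 2) ^+ 2 by rewrite exprn_gt0// divr_gt0.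
by apply: gig_gt0 => //; rewrite ?x2// ltW.
Qed.

Lemma measurable_expR_gig (b : R) :
  measurable_fun (`]0, +oo[ : set R) (fun s => expR (b * s) * H s).
Proof.
apply/measurable_EFinP.
apply: (eq_measurable_fun _ _
  (measurable_funTS (measurable_gig_section R b nu))).
move=> s; rewrite inE/= in_itv/= andbT => s0.
by rewrite gig_sectionE// gt_eqF.
Qed.

(** This is one of two nonnegative halves with a finite sum. *)
Lemma integrable_expR_gig (b : R) : -1 < b < 1 ->
  lebesgue_measure.-integrable `]0,
    +oo[ (EFin \o (fun s => expR (b * s) * H s)).
Proof.
move=> b1; apply/integrableP; split.
  by apply/measurable_EFinP; exact: measurable_expR_gig.
rewrite (_ : (\int[_]_(_ in _) _)%E =
    (\int[lebesgue_measure]_(s in `]0%R, +oo[) (expR (b * s) * H s)%:E)%E).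
  have e := ge0_integral_gig_halves R b nu b1 nu0.
  have := ltry (2 * Num.sqrt pi *
    ((1 - b ^+ 2) `^ (- (nu + 2^-1)) * Gamma (nu + 2^-1))).
  rewrite -e; apply: le_lt_trans; rewrite leeDl//.
  apply: integral_ge0 => s; rewrite /= in_itv/= andbT => s0.
  by rewrite lee_fin mulr_ge0 ?expR_ge0// ltW// H_gt0.
apply: eq_integral => s; rewrite inE/= in_itv/= andbT => s0.
by rewrite ger0_norm// mulr_ge0 ?expR_ge0// ltW// H_gt0.
Qed.

Lemma product_nincr s x y : 0 < s -> 0 <= x -> x <= y ->
  G y * H (y + s) <= G x * H (x + s).
Proof.
by move=> s0 x0 xy; apply:
  (bessel_product_nincr R (@Gamma R) (Gamma_gt0 R) (GammaS R)).
Qed.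

Let intH := integrable_expR_gig beta hbeta.

Let intHx x : 0 <= x -> lebesgue_measure.-integrable `]0, +oo[
  (EFin \o (fun s => expR (beta * s) * H (x + s))).
Proof. exact: (integrable_shifted R G H beta G_gt0 H_gt0 product_nincr intH).
  Qed.

Lemma bessel_integrandE t : 0 < t ->
  bessel_integrand beta nu t = 2 `^ (nu - 1) * (expR (beta * t) * H t).
Proof.
move=> t0; rewrite /bessel_integrand /H besselKE ?divr_gt0//.
have -> : 2 * (t / 2) = t by field.
rewrite powRM ?invr_ge0 ?(ltW t0)//.
have -> : (2^-1 : R) `^ nu = 2 `^ (- nu).
  by rewrite -powR_inv1// -powRrM mulN1r.
have -> : 2 `^ (nu - 1) = 2 `^ nu / 2 :> R.
  by rewrite powRB ?powRr1//; apply/implyP => _.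
rewrite powRN; have : (2 : R) `^ nu != 0 by rewrite gt_eqF// powR_gt0.
by move: (2 `^ nu) => a a0; field.
Qed.

Lemma integrable_bessel_integrand x : 0 < x ->
  lebesgue_measure.-integrable `[x, +oo[ (EFin \o bessel_integrand beta nu).
Proof.
move=> x0.
have sub : `[x, +oo[%classic `<=` `]0, +oo[%classic.
  by move=> t /=; rewrite !in_itv/= !andbT; exact: lt_le_trans.
have i : lebesgue_measure.-integrable `[x, +oo[
    (EFin \o (fun s => expR (beta * s) * H s)).
  by apply: integrableS (integrable_expR_gig beta hbeta) => //;
    exact: measurable_itv.
apply: eq_integrable (lebesgue_integrableZl R _ (2 `^ (nu - 1)) _ i) => //.
move=> t; rewrite inE => /sub /=; rewrite in_itv/= andbT => t0.
by rewrite bessel_integrandE.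
Qed.

(** The shift releases e^(beta x), which cancels e^(-beta x). The powers 2^(-nu) from I_nu and
    2^(nu-1) from K_nu leave 1/2. *)
Lemma bessel_exprE x : 0 < x ->
  bessel_expr beta nu x = 2^-1 * (G x * shifted_laplace H beta x).
Proof.
move=> x0.
have I : \int[lebesgue_measure]_(t in `[x, +oo[) bessel_integrand beta nu t =
    2 `^ (nu - 1) * expR (beta * x) * shifted_laplace H beta x.
  rewrite /shifted_laplace -RintegralZl;
    [|exact: measurable_itv|exact/intHx/ltW].
  rewrite /Rintegral; congr fine.
  rewrite (ge0_integral_translation R x).
  - rewrite (_ : [set s | `[x, +oo[%classic (s + x)%R] =
      `[0, +oo[%classic); last first.
      by apply/seteqP; split => s /=; rewrite !in_itv/= !andbT lerDr.
    rewrite -integral_itv_obnd_cbnd.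
      apply: eq_integral => s; rewrite inE/= in_itv/= andbT => s0.
      rewrite (bessel_integrandE _ (addr_gt0 s0 x0)) mulrDr expRD (addrC s).
      by congr EFin; ring.
    have i := lebesgue_integrableZl R _ (2 `^ (nu - 1) * expR (beta * x)) _
      (intHx x (ltW x0)).
    apply: (eq_measurable_fun _ _ (measurable_int _ i)) => s.
    rewrite inE/= in_itv/= andbT => s0.
    rewrite (bessel_integrandE _ (addr_gt0 s0 x0)) mulrDr expRD (addrC s).
    by congr EFin; ring.
  - exact: measurable_itv.
  - exact: measurable_int (integrable_bessel_integrand x x0).
  - move=> t; rewrite /= in_itv/= andbT => xt.
    have t0 := lt_le_trans x0 xt.
    by rewrite lee_fin bessel_integrandE// !mulr_ge0 ?powR_ge0 ?expR_ge0 ?ltW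
      ?H_gt0.
rewrite /bessel_expr I besselIE//; last by move: nu0; lra.
rewrite powRM ?invr_ge0 ?(ltW x0)// -/(G x).
have -> : (2^-1 : R) `^ nu = 2 `^ (- nu).
  by rewrite -powR_inv1// -powRrM mulN1r.
have -> : 2 `^ (nu - 1) = 2 `^ nu / 2 :> R.
  by rewrite powRB ?powRr1//; apply/implyP => _.
rewrite powRN; have : (2 : R) `^ nu != 0 by rewrite gt_eqF// powR_gt0.
have : x `^ nu != 0 by rewrite gt_eqF// powR_gt0.
rewrite expRN; have : expR (beta * x) != 0 by rewrite gt_eqF// expR_gt0.
move: (expR _) (x `^ nu) (2 `^ nu) => e a b e0 a0 b0; field.
by rewrite e0 a0 b0.
Qed.

(* The value at x = 0 of the expression to bound. *)
Definition half_bound : R := 2^-1 * (Gamma (nu + 1))^-1 *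
  shifted_laplace H beta 0.

(** The right-hand side is the same expression with the integral for - beta added; that integral is
    positive, whence strictness. *)
Lemma half_bound_lt :
  half_bound < Num.sqrt pi * Gamma (nu + 2^-1) /
               ((1 - beta ^+ 2) `^ (nu + 2^-1) * Gamma (nu + 1)).
Proof.
have nbeta : -1 < - beta < 1 by move: hbeta => /andP[b1 b2]; apply/andP;
  split; lra.
have e := ge0_integral_gig_halves R beta nu hbeta nu0.
have I0 b : -1 < b < 1 -> (shifted_laplace H b 0)%:E =
    (\int[lebesgue_measure]_(s in `]0%R, +oo[) (expR (b * s) * H s)%:E)%E.
  move=> b1; rewrite /shifted_laplace /Rintegral fineK.
    by apply: eq_integral => s _; rewrite add0r.
  under eq_integral do rewrite add0r.
  exact: integrable_fin_num (integrable_expR_gig b b1).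
rewrite -!I0// -EFinD in e; case: e => e.
have pos : 0 < shifted_laplace H (- beta) 0.
  apply: Rintegral_gt0; first exact: measurable_itv.
  - by rewrite lebesgue_measure_itv/= ltry sube0 ltry.
  - under [X in _.-integrable _ X]eq_fun do rewrite /= add0r.
    exact: (integrable_expR_gig (- beta) nbeta).
  - move=> s; rewrite /= in_itv/= andbT => s0.
    by rewrite mulr_gt0 ?expR_gt0// add0r H_gt0.
have g0 : 0 < Gamma (nu + 1) by apply: Gamma_gt0; move: nu0; lra.
rewrite powRN in e.
have bb : 0 < (1 - beta ^+ 2) `^ (nu + 2^-1).
  apply: powR_gt0; rewrite (_ : 1 - beta ^+ 2 = (1 - beta) * (1 + beta)); last
    by ring.
  by move: hbeta => /andP[b1 b2]; rewrite mulr_gt0 ?subr_gt0// -ltrBlDl sub0r.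
rewrite /half_bound.
set A := shifted_laplace H beta 0 in e *; set B := shifted_laplace H
  (- beta) 0 in e pos.
have -> : Num.sqrt pi * Gamma (nu + 2^-1) /
  ((1 - beta ^+ 2) `^ (nu + 2^-1) * Gamma (nu + 1)) =
    2^-1 * (Gamma (nu + 1))^-1 * (A + B).
  rewrite e; move: (Gamma (nu + 1)) (Gamma (nu + 2^-1)) (_ `^ _) g0 bb =>
    x y z x0 z0.
  by field; rewrite !gt_eqF.
by rewrite ltr_pM2l ?ltrDl// mulr_gt0 ?invr_gt0.
Qed.

Lemma bessel_expr_bound (D : R) : half_bound < D ->
  bessel_expr_defined beta nu /\
  forall x, 0 <= x -> `|extend0 (bessel_expr beta nu) x| < D.
Proof.
move=> BD.
pose B x := 2^-1 * (G x * shifted_laplace H beta x).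
have B0 : B 0 = half_bound.
  by rewrite /half_bound /B /G mul0r expr0n/= bessel_series0 mulrA.
have [||||c b] := extend0_bound R (bessel_expr beta nu) B D.
- exact: bessel_exprE.
- move=> x x0; apply: mulr_ge0; first by rewrite invr_ge0.
  apply: mulr_ge0; first exact/ltW.
  exact: (shifted_laplace_ge0 R H beta H_gt0).
- move=> x y x0 xy; apply: ler_wpM2l; first by rewrite invr_ge0.
  exact: (product_shifted_laplace_nincr R G H beta G_gt0 H_gt0 product_nincr
    intH).
- by rewrite B0.
by split => //; split => //; exact: integrable_bessel_integrand.
Qed.

End bessel_expr_bound.


(** * Lower bounds for the gamma function *)

Section gamma_lower_bound.
Variable R : realType.
Implicit Types nu : R.

Lemma Gamma1 : Gamma (1 : R) = 1.
Proof.
rewrite /Gamma /Rintegral.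
rewrite (_ : (\int[_]_(_ in _) _)%E = 1%E)//.
transitivity (\int[lebesgue_measure]_(t in `]0%R, +oo[) (expR (- t : R))%:E)%E.
  apply: eq_integral => t; rewrite inE/= in_itv/= andbT => t0.
  by rewrite subrr powRr0 mul1r.
have cE : continuous (fun t : R => expR (- t)).
  by move=> t; apply: continuous_comp;
    [exact: opp_continuous|exact: continuous_expR].
rewrite integral_itv_obnd_cbnd; last first.
  by apply: measurable_funTS; apply/measurable_EFinP;
    exact: continuous_measurable_fun.
rewrite (@ge0_continuous_FTC2y _ _ (fun t => - expR (- t)) 0 0).
- by rewrite oppr0 expR0 -EFinB opprK add0r.
- by move=> t _; exact: expR_ge0.
- exact: continuous_subspaceT.
- by rewrite -oppr0; apply: cvgN; exact: cvgr_expR.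
- by move=> t _; exact: ex_derive.
- by apply: cvg_at_right_filter; apply: cvgN; exact: cE.
- move=> t _; rewrite derive1E derive_val /GRing.scale/=; ring.
Qed.

Let intG (a p : R) : 0 < p -> 0 < a ->
  lebesgue_measure.-integrable setT (EFin \o gig_kernel a p 0).
Proof. by move=> p0 a0; apply: integrable_gig_kernel => //;
  rewrite a0 orbT. Qed.

(** For nu <= 0, u^nu >= 1 + nu ln u >= 1 + nu (u - 1). Integrated against e^(-u), the last
    expression gives 1, since Gamma(1) = Gamma(2) = 1. *)
Lemma Gamma_ge1 nu : -1 < nu -> nu <= 0 -> 1 <= Gamma (nu + 1).
Proof.
move=> nu1 nu0.
have e : 1 = (1 - nu) * gig 1 1 0 + nu * gig (1 + 1) 1 0.
  by rewrite -!GammaE GammaS// Gamma1; ring.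
have i1 := integrableZl measurableT (1 - nu) (intG 1 1 ltr01 ltr01).
have i2 := integrableZl measurableT nu
  (intG (1 + 1) 1 ltr01 (addr_gt0 ltr01 ltr01)).
rewrite [leLHS]e GammaE /gig -!RintegralZl//; last 2 first.
- exact: intG.
- exact: intG.
rewrite -RintegralD//; apply: le_Rintegral => //.
- exact: (integrableD measurableT i1 i2).
- by apply: intG => //; lra.
- move=> v _; rewrite (gig_kernelDl R 1 1 0 v 1) mul1r.
  rewrite (addrC nu) (gig_kernelDl R 1 1 0 v nu) mulrA -mulrDl ler_pM2r
    ?gig_kernel_gt0//.
  have h1 := expR_ge1Dx (nu * v); have h2 := expR_ge1Dx v.
  nra.
Qed.

(** Integrating (2u)^nu >= 1 - e^(-2u) against e^(-u) over u > 0 gives 1 - 1/3. *)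
Lemma Gamma_powR2_ge nu : 0 <= nu -> nu <= 1 -> 2 / 3 <= 2 `^ nu * Gamma
  (nu + 1).
Proof.
move=> nu0 nu1.
have e : 2 / 3 = gig (1 : R) 1 0 - gig (1 : R) 3 0.
  by rewrite (gig_scaling R 1 3)// powRN powRr1// -GammaE Gamma1; field.
have i1 : lebesgue_measure.-integrable setT
  (EFin \o gig_kernel (1 : R) 1 0) by exact: intG.
have i2 : lebesgue_measure.-integrable setT
  (EFin \o gig_kernel (1 : R) 3 0) by exact: intG.
have i3 : lebesgue_measure.-integrable setT (EFin \o gig_kernel (nu + 1) 1 0).
  by apply: intG => //; lra.
rewrite [leLHS]e GammaE /gig -RintegralZl// -RintegralB//;
  apply: le_Rintegral => //.
- exact: (integrableB measurableT i1 i2).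
- exact: (integrableZl measurableT (2 `^ nu) i3).
- move=> v _; rewrite (addrC nu) gig_kernelDl mulrA.
  have -> : gig_kernel (1 : R) 3 0 v =
      expR (- (2 * expR v)) * gig_kernel 1 1 0 v.
    by rewrite /gig_kernel -expRD; congr expR; ring.
  rewrite -[X in X - _]mul1r -mulrBl ler_pM2r ?gig_kernel_gt0//.
  have -> : 2 `^ nu * expR (nu * v) = (2 * expR v) `^ nu.
    by rewrite powRM ?expR_ge0// [X in _ = _ * X]/powR gt_eqF ?expR_gt0// expRK.
  (* 1 - e^(-w) <= min(1, w) <= w^nu *)
  move: (2 * expR v) (mulr_gt0 (ltr0Sn R 1) (expR_gt0 v)) => w w0.
  have [w1|w1] := leP 1 w.
    apply: (@le_trans _ _ 1); first by rewrite gerBl expR_ge0.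
    by rewrite -(powRr0 w); exact: ler_powR.
  apply: (@le_trans _ _ w); last by apply: ger1_powR => //; rewrite w0 ltW.
  by have := expR_ge1Dx (- w); lra.
Qed.

(** As e + 1 >= 3, it suffices that 2^nu Gamma(nu+1) >= 2/3. For nu < 0 this follows from
    Gamma(nu+1) >= 1 and 2^nu >= 2^(-1/2) >= 2/3. *)
Lemma Gamma_numeric_bound nu : `|nu| < 2^-1 ->
  2 <= (expR 1 + 1) * 2 `^ nu * Gamma (nu + 1).
Proof.
rewrite ltr_norml => /andP[nu1 nu2].
have e2 : 3 <= expR 1 + 1 :> R by have := expR_ge1Dx (1 : R); lra.
rewrite -mulrA.
have [nu0|nu0] := leP 0 nu.
  have := Gamma_powR2_ge nu nu0; move: (_ * Gamma _) =>
    g /(_ (ltac:(lra))) g0; nra.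
have g1 : 1 <= Gamma (nu + 1) by apply: Gamma_ge1; lra.
have s2 : 2 / 3 <= 2 `^ nu :> R.
  apply: (@le_trans _ _ (2 `^ (- 2^-1))); last by apply: ler_powR; lra.
  rewrite powRN powR12_sqrt// -[leLHS]invrK lef_pV2 ?posrE ?invr_gt0
    ?sqrtr_gt0//.
  rewrite invf_div -[leRHS]ger0_norm// -sqrtr_sqr ler_sqrt; lra.
move: (2 `^ nu) (Gamma _) s2 g1 => p g p0 g0.
have pg : 2 / 3 <= p * g by nra.
nra.
Qed.

End gamma_lower_bound.

Theorem theorem3p2 (R : realType) (beta : R) (hbeta : -1 < beta < 1) :
  (forall nu : R, 2^-1 <= nu ->
    bessel_expr_defined beta nu /\
    forall x : R, 0 <= x ->
      `|extend0 (bessel_expr beta nu) x| <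
        Num.sqrt pi * Gamma (nu + 2^-1) /
        ((1 - beta ^+ 2) `^ (nu + 2^-1) * Gamma (nu + 1))) /\
  (forall nu : R, `|nu| < 2^-1 ->
    bessel_expr_defined beta nu /\
    forall x : R, 0 <= x ->
      `|extend0 (bessel_expr beta nu) x| <
        (expR 1 + 1) * 2 `^ nu * Gamma (nu + 2^-1) / (1 - `|beta|)).
Proof.
split=> nu hnu.
  apply: bessel_expr_bound => //; first by left.
  by apply: half_bound_lt => //; left.
have hnu' : 2^-1 <= nu \/ `|nu| < 2^-1 by right.
apply: bessel_expr_bound => //.
apply: lt_le_trans (half_bound_lt R beta nu hbeta hnu') _.
have /andP[nu1 nu2] : - 2^-1 < nu < 2^-1 by rewrite -ltr_norml.
have b1 : `|beta| < 1 by rewrite ltr_norml.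
have b0 : 0 <= `|beta| by [].
have b2 : 0 < 1 - `|beta| by lra.
have bsq : beta ^+ 2 = `|beta| ^+ 2 by rewrite real_normK ?num_real.
(* Since beta^2 <= |beta|, 1 - |beta| <= 1 - beta^2; a base in [0, 1] does not decrease under an
   exponent nu + 1/2 in ]0, 1[. *)
have bp : 1 - `|beta| <= (1 - beta ^+ 2) `^ (nu + 2^-1).
  apply: (@le_trans _ _ (1 - beta ^+ 2)); first by rewrite bsq; nra.
  by apply: ger1_powR; [rewrite bsq; apply/andP; split; nra|lra].
have g1 : 0 < Gamma (nu + 2^-1) by apply: Gamma_gt0; lra.
have g2 : 0 < Gamma (nu + 1) by apply: Gamma_gt0; lra.
have pi2 : Num.sqrt pi <= 2 :> R.
  rewrite -[leRHS]ger0_norm// -sqrtr_sqr ler_sqrt.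
    by have := @pihalf_lt2 R; lra.
  by rewrite exprn_ge0.
have num := Gamma_numeric_bound R nu hnu.
have p0 := lt_le_trans b2 bp.
move: (Gamma (nu + 2^-1)) (Gamma (nu + 1)) g1 g2 num => u w u0 w0 num.
(* With denominators cleared, two comparisons remain: sqrt(pi) <= 2 <= (e+1) 2^nu Gamma(nu+1), and
   [bp]. *)
rewrite ler_pdivrMr ?mulr_gt0// mulrAC ler_pdivlMr//.
move: ((1 - beta ^+ 2) `^ (nu + 2^-1)) bp p0 => q bq q0.
have -> : (expR 1 + 1) * 2 `^ nu * u * (q * w) =
    ((expR 1 + 1) * 2 `^ nu * w) * u * q by ring.
apply: ler_pM => //; first by rewrite mulr_ge0 ?sqrtr_ge0 ?ltW.
  exact: ltW.
by rewrite ler_pM2r// (le_trans pi2).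
Qed.
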